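(* Fix $p\in(0,\infty)$. The equation $$0=\partial_t(\sigma^p)+\tfrac12\,\sigma^2\,\partial_{xx}^2(\sigma^p)$$ on $[0,1)\times(0,1)$, with the boundary condition $\sigma(t,0)=\sigma(t,1)=0$, has a nonnegative solution $\sigma$ such that for $(t,x)\in[0,1)\times[0,1/2]$ $$\partial_x\sigma(t,x)=-\partial_x\sigma(t,1-x)=\begin{cases}\dfrac{1}{p\sqrt{1-t}}\sqrt{\dfrac{p^2}{1-p}-C_p(1-t)^{1-p}\sigma^{2-2p}(t,x)},&p\in(0,1),\\[2mm]\dfrac{1}{p\sqrt{1-t}}\sqrt{C_p(1-t)^{1-p}\sigma^{2-2p}(t,x)-\dfrac{p^2}{p-1}},&p\in(1,\infty),\\[2mm]\dfrac{1}{\sqrt{1-t}}\sqrt{-2\log\sigma(t,x)-\log(1-t)-C_1},&p=1,\end{cases}$$ where $C_p$ is a unique positive constant (in particular $C_{1/2}=\sqrt2$ and $C_1=\log(2\pi)$). Furthermore $$\sigma(t,x)\le\frac{1}{\sqrt{1-t}}\left(\frac{|2p-2|\,C_p}{2p^2}\right)^{\frac{1}{2p-2}}\ \text{ if }p\ne1,\qquad \sigma(t,x)\le\frac{1}{\sqrt{1-t}}\,e^{-C_1/2}\ \text{ if }p=1,$$ and $\sigma(t,x)=0$ only at $x=0,1$.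
   Context: Here $\partial_x\sigma(t,1-x)$ means the $x$-derivative of $\sigma(t,\cdot)$ evaluated at the point $1-x$. For $p\ge1$ the formula at the endpoint $x=0$ (where $\sigma=0$) is understood with both sides equal to $+\infty$ as one-sided derivative. *)

(* Defs.v *)
From Stdlib Require Export Reals.
From Coquelicot Require Export Coquelicot.
Open Scope R_scope.

(* x^y for x >= 0, with 0^y = 0, the right value for y > 0: Stdlib's
   [Rpower 0 y] is 1. *)
Definition rpow (x y : R) : R := if Rlt_dec 0 x then Rpower x y else 0.

Definition time (t : R) : Prop := 0 <= t < 1.
Definition space (x : R) : Prop := 0 <= x <= 1.

(* The derivative at x of f restricted to D: one-sided at an endpoint of D,
   and possibly infinite. *)
Definition is_derive_in (D : R -> Prop) (f : R -> R) (x : R) (l : Rbar) : Prop :=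
  filterlim (fun y => (f y - f x) / (y - x)) (within D (locally' x))
            (Rbar_locally l).

(* Nonnegative classical solution: sigma is continuous up to the lateral
   boundary and sigma^p is C^{1,2} on [0,1) x (0,1); the time derivative at
   t = 0 is the right one.  Without continuity at x = 0 and x = 1 the boundary
   condition would not constrain sigma in the interior. *)
Record is_solution (p : R) (sigma : R -> R -> R) : Prop := {
  sol_nonneg : forall t x, time t -> space x -> 0 <= sigma t x;
  sol_continuous :
    continuous_on (fun z : R * R => time (fst z) /\ space (snd z))
                  (fun z : R * R => sigma (fst z) (snd z));
  sol_equation : exists ut ux uxx : R -> R -> R,
    (forall v, v = ut \/ v = ux \/ v = uxx ->
       continuous_on (fun z : R * R => time (fst z) /\ 0 < snd z < 1)
                     (fun z : R * R => v (fst z) (snd z))) /\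
    (forall t x, time t -> 0 < x < 1 ->
       is_derive_in time (fun s => rpow (sigma s x) p) t (ut t x) /\
       is_derive (fun y => rpow (sigma t y) p) x (ux t x) /\
       is_derive (fun y => ux t y) x (uxx t x) /\
       0 = ut t x + 1 / 2 * sigma t x ^ 2 * uxx t x);
  sol_boundary : forall t, time t -> sigma t 0 = 0 /\ sigma t 1 = 0
}.

(* The quantity under the square root, at s = sigma(t,x); for p >= 1 both
   s^(2-2p) (p > 1) and -2 log s (p = 1) are +oo at s = 0. *)
Definition radicand (p C t s : R) : Rbar :=
  if Rlt_dec p 1 then
    Finite (p ^ 2 / (1 - p) - C * Rpower (1 - t) (1 - p) * rpow s (2 - 2 * p))
  else if Req_EM_T s 0 then p_infty
  else if Req_EM_T p 1 then Finite (- 2 * ln s - ln (1 - t) - C)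
  else
    Finite (C * Rpower (1 - t) (1 - p) * rpow s (2 - 2 * p) - p ^ 2 / (p - 1)).

Definition Rbar_sqrt (r : Rbar) : Rbar :=
  match r with
  | Finite r => Finite (sqrt r)
  | p_infty => p_infty
  | m_infty => Finite 0
  end.

(* For p = 1 the prefactor is 1 / sqrt (1 - t). *)
Definition slope (p C t s : R) : Rbar :=
  Rbar_mult (Finite (1 / (p * sqrt (1 - t)))) (Rbar_sqrt (radicand p C t s)).

(* [sqrt] is 0 on negative numbers, so that the square root makes sense has to
   be part of the formula. *)
Definition gradient_formula (p C : R) (sigma : R -> R -> R) : Prop :=
  forall t x, time t -> 0 <= x <= 1 / 2 ->
    Rbar_le (Finite 0) (radicand p C t (sigma t x)) /\
    is_derive_in space (sigma t) x (slope p C t (sigma t x)) /\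
    is_derive_in space (sigma t) (1 - x) (Rbar_opp (slope p C t (sigma t x))).

Definition upper_bound (p C t : R) : R :=
  1 / sqrt (1 - t) *
  (if Req_EM_T p 1 then exp (- C / 2)
   else Rpower (Rabs (2 * p - 2) * C / (2 * p ^ 2)) (1 / (2 * p - 2))).

(* Main.v *)
Require Import Defs.
From Stdlib Require Import Reals Lra.
From Coquelicot Require Import Coquelicot.
Open Scope R_scope.

(** Existence. With sigma(t,x) = g(x) / sqrt(1-t) the equation becomes
    (g^p)'' = - p g^(p-2), whose first integral is the gradient formula:
    (p-1) g'^2 + 1 = (M/g)^(2p-2), where M is the largest value of g and where
    C M^(2-2p) = p^2 / |p-1| (for p = 1, g'^2 = 2 log (M/g) and C = -2 log M).
    All p are treated at once by the parametrization g = M exp(-w^2/2), with w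
    running over the whole line: then g' = - S(w) and dx = M rho(w) dw, where
    S(w) = w sqrt(E), rho(w) = exp(-w^2/2) / sqrt(E), E = E((p-1)w^2), and
    E(z) = (exp(z)-1)/z is smooth and positive. Since rho decays like a Gaussian
    ([density_le]), the interval on which g > 0 has finite length 2 M L, with
    L the integral of rho over a half-line ([halfwidth]), and x -> w is obtained
    by inverting the integral of rho. The boundary condition says 2 M L = 1, which
    fixes M, hence C. The derivatives at x = 0 and x = 1, infinite if p >= 1, are
    the limits of S at infinity ([is_derive_in_right_limit], [slope_at_lim]).

    Uniqueness. Let sigma' be any solution satisfying the gradient formula for
    the constant of the amplitude M, and h = sqrt(1-t) sigma'(t,.) at a fixed
    time. The formula makes h vanish only at 0 and nondecreasing with values at
    most M on [0,1/2], and, read from both sides, gives h'(1/2) = 0, that is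
    h(1/2) = M ([solution_rescaled]). While h < M, separation of variables shows
    that h is the profile started at 0, so that it reaches M after the length M L
    ([rescaled_position]); hence M L <= 1/2. The gradient formula alone would
    allow M L < 1/2, with h constant afterwards, because the square root
    vanishes at M. The equation excludes it ([no_plateau]): there sigma'^p would
    have a zero second derivative in x, while it depends on t. So M L = 1/2.

    Values. For p = 1/2, the position equals the slope, so that L is the limit
    sqrt 2 of the slope. For p = 1, rho is the Gaussian and L^2 = pi/2. *)

(** * Calculus on the line *)

Lemma locally_imp2 (x : R) (P Q S : R -> Prop) :
  (forall y, P y -> Q y -> S y) -> locally x P -> locally x Q -> locally x S.
Proof.
  intros H HP HQ.
  refine (filter_imp (fun y => P y /\ Q y) S _ (filter_and _ _ HP HQ)).
  intros y [H1 H2]; now apply H.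
Qed.

Lemma locally_of_interval (a b x : R) (P : R -> Prop) :
  a < x < b -> (forall y, a < y < b -> P y) -> locally x P.
Proof.
  intros Hx HP.
  apply locally_interval with (Finite a) (Finite b); simpl; [easy | easy | ].
  intros y H1 H2; now apply HP.
Qed.

Lemma is_derive_quotient (f : R -> R) (x l : R) :
  is_derive f x l <->
  filterlim (fun y => (f y - f x) / (y - x)) (locally' x) (locally l).
Proof.
  rewrite is_derive_Reals.
  unfold derivable_pt_lim.
  split.
  - intros H P [eps HP].
    destruct (H eps (cond_pos eps)) as [d Hd].
    exists d; intros y Hy Hne.
    apply HP.
    assert (Hq := Hd (y - x) ltac:(lra) Hy).
    rewrite Rplus_minus in Hq; exact Hq.
  - intros H eps Heps.
    destruct (H (fun z => Rabs (z - l) < eps)) as [d Hd].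
    { now exists (mkposreal eps Heps); intros z Hz. }
    exists d; intros h Hh Hhd.
    assert (Hq := Hd (x + h)).
    replace (x + h - x) with h in Hq by ring.
    apply Hq; [ | lra].
    change (Rabs (x + h - x) < d).
    now replace (x + h - x) with h by ring.
Qed.

Lemma is_derive_in_of_is_derive (D : R -> Prop) (f : R -> R) (x l : R) :
  is_derive f x l -> is_derive_in D f x l.
Proof.
  intros H.
  apply is_derive_quotient in H.
  intros P HP.
  destruct (H P HP) as [d Hd].
  exists d; intros y Hy Hne _.
  exact (Hd y Hy Hne).
Qed.

Lemma is_derive_of_is_derive_in (D : R -> Prop) (f : R -> R) (x l : R) :
  locally x D -> is_derive_in D f x l -> is_derive f x l.
Proof.
  intros HD H.
  apply is_derive_quotient.
  intros P HP.
  assert (HPx : locally x (fun y => y <> x -> D y -> P ((f y - f x) / (y - x))))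
    by exact (H P HP).
  refine (locally_imp2 _ _ _ _ _ HD HPx); intros y Hy HPy Hne.
  now apply HPy.
Qed.

Lemma is_derive_in_ext (D : R -> Prop) (f g : R -> R) (x : R) (l : Rbar) :
  D x -> (forall y, D y -> f y = g y) ->
  is_derive_in D f x l -> is_derive_in D g x l.
Proof.
  intros Hx Hfg.
  apply filterlim_within_ext.
  intros y Hy.
  now rewrite !Hfg.
Qed.

Lemma is_derive_in_scal (D : R -> Prop) (f : R -> R) (x c : R) (l : Rbar) :
  is_derive_in D f x l ->
  is_derive_in D (fun y => c * f y) x (Rbar_mult c l).
Proof.
  intros H.
  apply (filterlim_ext (fun y => c * ((f y - f x) / (y - x)))).
  { intros y; unfold Rdiv; ring. }
  exact (filterlim_comp _ _ _ _ _ _ _ _ H (filterlim_Rbar_mult_l c l)).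
Qed.

(** Caratheodory's form of the inverse function rule: the difference quotient
    of the inverse is the reciprocal of that of the function. *)
Lemma is_derive_inverse (f g : R -> R) (z d : R) :
  is_derive f (g z) d -> d <> 0 -> continuous g z ->
  locally z (fun y => f (g y) = y) ->
  is_derive g z (/ d).
Proof.
  intros Hf Hd Hg Hfg.
  apply is_derive_quotient in Hf.
  apply is_derive_quotient.
  assert (Hz : f (g z) = z) by exact (locally_singleton _ _ Hfg).
  assert (Hne : locally' z (fun y => g y <> g z)).
  { refine (locally_imp2 _ _ _ _ _ Hfg Hfg); intros y Hy _ Hyz Heq.
    apply Hyz; rewrite <- Hy, Heq; exact Hz. }
  assert (Hg' : filterlim g (locally' z) (locally' (g z))).
  { intros P HP.
    assert (HPz : locally z (fun y => g y <> g z -> P (g y))) by exact (Hg _ HP).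
    refine (locally_imp2 _ _ _ _ _ Hne HPz); intros y H1 H2 Hyz.
    exact (H2 (H1 Hyz)). }
  assert (Hq := filterlim_comp _ _ _ _ _ _ _ _ Hg' Hf).
  assert (Hi := filterlim_comp _ _ _ _ _ _ _ _ Hq
                  (filterlim_Rbar_inv (Finite d) ltac:(congruence))).
  refine (filterlim_ext_loc _ _ _ Hi).
  refine (locally_imp2 _ _ _ _ _ Hne Hfg); intros y H1 H2 Hyz.
  simpl.
  rewrite H2, Hz.
  specialize (H1 Hyz).
  field; split; intros H0; [apply Hyz | apply H1]; lra.
Qed.

Lemma continuous_of_is_derive (f : R -> R) (x l : R) :
  is_derive f x l -> continuous f x.
Proof.
  intros H.
  apply (ex_derive_continuous (K := R_AbsRing) (V := R_NormedModule) f x).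
  now exists l.
Qed.

(** Continuity of k is enough, so that [slope_at] below can be differentiated at
    0 without the derivative of [expmean] there. *)
Lemma is_derive_mult_at_0 (k : R -> R) :
  continuous k 0 -> is_derive (fun w => w * k w) 0 (k 0).
Proof.
  intros Hk.
  apply is_derive_quotient.
  apply (filterlim_ext_loc k).
  - exists (mkposreal 1 Rlt_0_1); intros y _ Hy; field; lra.
  - intros P HP.
    destruct (Hk P HP) as [d Hd].
    exists d; intros y Hy _; exact (Hd y Hy).
Qed.

(** That c lies strictly between a and b is what lets f fail to be differentiable
    at the ends, as the solution does at x = 0. *)
Lemma mean_value_open (f df : R -> R) (a b : R) :
  a < b ->
  (forall x, a < x < b -> is_derive f x (df x)) ->
  (forall x, a <= x <= b -> continuous f x) ->
  exists c, a < c < b /\ f b - f a = df c * (b - a).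
Proof.
  intros Hab Hd Hc.
  assert (pr1 : forall c, a < c < b -> derivable_pt f c).
  { intros c H; exists (df c); apply is_derive_Reals; now apply Hd. }
  assert (pr2 : forall c, a < c < b -> derivable_pt id c).
  { intros c _; apply derivable_pt_id. }
  destruct (MVT f id a b pr1 pr2 Hab) as [c [P HP]].
  - intros c H; apply continuity_pt_filterlim; now apply Hc.
  - intros c _; apply derivable_continuous_pt, derivable_pt_id.
  - exists c; split; [exact P | ].
    replace (derive_pt id c (pr2 c P)) with 1 in HP.
    2: { symmetry; apply derive_pt_eq_0, derivable_pt_lim_id. }
    replace (derive_pt f c (pr1 c P)) with (df c) in HP.
    2: { symmetry; apply derive_pt_eq_0, is_derive_Reals; now apply Hd. }
    unfold id in HP; lra.
Qed.

(** One-sided version of the mean value theorem at an end of an interval: a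
    limit, finite or not, of the derivative is a derivative. *)
Lemma is_derive_in_right_limit (f df : R -> R) (D : R -> Prop) (a b : R) (l : Rbar) :
  a < b -> (forall x, D x -> a <= x) ->
  (forall x, continuous f x) ->
  (forall x, a < x < b -> is_derive f x (df x)) ->
  filterlim df (at_right a) (Rbar_locally l) ->
  is_derive_in D f a l.
Proof.
  intros Hab HD Hc Hd Hl P HP.
  destruct (Hl P HP) as [e He].
  assert (Hm : 0 < Rmin e (b - a)) by (apply Rmin_glb_lt; [apply cond_pos | lra]).
  exists (mkposreal _ Hm); intros y Hy Hne HDy.
  assert (Hay : a < y) by (specialize (HD y HDy); lra).
  assert (Hy' : y - a < Rmin e (b - a)).
  { change (Rabs (y - a) < Rmin e (b - a)) in Hy.
    rewrite Rabs_pos_eq in Hy; lra. }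
  assert (H1 := Rmin_l e (b - a)).
  assert (H2 := Rmin_r e (b - a)).
  destruct (mean_value_open f df a y Hay) as [c [Hc1 Hc2]].
  - intros x Hx; apply Hd; lra.
  - intros x _; apply Hc.
  - rewrite Hc2.
    replace (df c * (y - a) / (y - a)) with (df c) by (field; lra).
    apply He; [ | apply Hc1].
    change (Rabs (c - a) < e).
    rewrite Rabs_pos_eq; lra.
Qed.

Lemma is_derive_in_reflect (f : R -> R) (x : R) (l : Rbar) :
  (forall y, f (1 - y) = f y) ->
  is_derive_in space f x l -> is_derive_in space f (1 - x) (Rbar_opp l).
Proof.
  intros Hf H.
  assert (Hr : filterlim (fun y => 1 - y) (within space (locally' (1 - x)))
                 (within space (locally' x))).
  { intros P [d HP]; exists d; intros y Hy Hne HD.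
    apply HP.
    - change (Rabs (1 - y - x) < d).
      change (Rabs (y - (1 - x)) < d) in Hy.
      replace (1 - y - x) with (- (y - (1 - x))) by ring.
      now rewrite Rabs_Ropp.
    - lra.
    - unfold space in *; lra. }
  assert (Ho := filterlim_comp _ _ _ _ _ _ _ _
                  (filterlim_comp _ _ _ _ _ _ _ _ Hr H) (filterlim_Rbar_opp l)).
  refine (filterlim_ext_loc _ _ _ Ho).
  exists (mkposreal 1 Rlt_0_1); intros y _ Hne _.
  simpl; rewrite !Hf.
  field; lra.
Qed.

Lemma is_derive_Rplus (f g : R -> R) (x a b : R) :
  is_derive f x a -> is_derive g x b -> is_derive (fun y => f y + g y) x (a + b).
Proof.
  intros Hf Hg.
  exact (is_derive_plus (K := R_AbsRing) (V := R_NormedModule) f g x a b Hf Hg).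
Qed.

Lemma is_derive_Rmult (f g : R -> R) (x a b : R) :
  is_derive f x a -> is_derive g x b ->
  is_derive (fun y => f y * g y) x (a * g x + f x * b).
Proof.
  intros Hf Hg.
  exact (is_derive_mult (K := R_AbsRing) f g x a b Hf Hg Rmult_comm).
Qed.

Lemma is_derive_Rcomp (f g : R -> R) (x a b : R) :
  is_derive f (g x) a -> is_derive g x b -> is_derive (fun y => f (g y)) x (b * a).
Proof.
  intros Hf Hg.
  exact (is_derive_comp (V := R_NormedModule) f g x a b Hf Hg).
Qed.

Lemma constant_of_derive_0 (f : R -> R) (a b : R) :
  a <= b -> (forall x, a <= x <= b -> is_derive f x 0) -> f a = f b.
Proof.
  intros [Hab | ->] H; [ | easy].
  exact (eq_is_derive (V := R_NormedModule) f a b H Hab).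
Qed.

Lemma continuous_on_product (a b : R -> R) (A B : R -> Prop) :
  (forall t, A t -> continuous a t) -> (forall x, B x -> continuous b x) ->
  continuous_on (fun z : R * R => A (fst z) /\ B (snd z))
    (fun z => a (fst z) * b (snd z)).
Proof.
  intros Ha Hb [t x] [Ht Hx].
  assert (H : continuous (fun z : R * R => a (fst z) * b (snd z)) (t, x)).
  { apply (continuous_mult (K := R_AbsRing)).
    - apply (continuous_comp fst a); [apply continuous_fst | now apply Ha].
    - apply (continuous_comp snd b); [apply continuous_snd | now apply Hb]. }
  intros P HP.
  destruct (H P HP) as [d Hd].
  exists d; intros z Hz _; exact (Hd z Hz).
Qed.

(** To the left of a zero, a nonnegative function has nonpositive difference
    quotients. Hence a solution whose slope at the value 0 is positive or infinite
    vanishes on [0,1/2] only at x = 0. *)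
Lemma no_positive_slope_at_zero (f : R -> R) (x : R) (l : Rbar) :
  0 < x <= 1 -> (forall y, space y -> 0 <= f y) -> f x = 0 -> Rbar_lt 0 l ->
  ~ is_derive_in space f x l.
Proof.
  intros Hx Hf Hfx Hl H.
  assert (Hpos : Rbar_locally l (fun v => 0 < v)).
  { destruct l as [l | | ]; simpl in Hl; [ | now exists 0 | easy].
    exists (mkposreal l Hl); intros y Hy.
    change (Rabs (y - l) < l) in Hy; apply Rabs_def2 in Hy; lra. }
  destruct (H _ Hpos) as [d Hd].
  assert (Hd0 := cond_pos d).
  set (e := Rmin x d / 2).
  assert (He1 := Rmin_l x d).
  assert (He2 := Rmin_r x d).
  assert (He : 0 < Rmin x d) by (apply Rmin_glb_lt; lra).
  assert (Hsp : space (x - e)) by (unfold space, e; lra).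
  specialize (Hd (x - e)); rewrite Hfx in Hd.
  assert (Hq : 0 < (f (x - e) - 0) / (x - e - x)).
  { apply Hd; [ | unfold e; lra | exact Hsp].
    change (Rabs (x - e - x) < d).
    replace (x - e - x) with (- e) by ring.
    rewrite Rabs_Ropp, Rabs_pos_eq; unfold e; lra. }
  specialize (Hf _ Hsp).
  replace ((f (x - e) - 0) / (x - e - x)) with (- (f (x - e) / e)) in Hq
    by (field; unfold e; lra).
  assert (0 <= f (x - e) / e) by (apply Rdiv_le_0_compat; [easy | unfold e; lra]).
  lra.
Qed.

Lemma exp_le_mono (x y : R) : x <= y -> exp x <= exp y.
Proof. intros [H | ->]; [now apply Rlt_le, exp_increasing | apply Rle_refl]. Qed.

(** * The slope and the density of position as functions of the parameter *)

(** The mean of [exp] over the segment from 0 to z. *)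
Definition expmean (z : R) : R := if Req_EM_T z 0 then 1 else (exp z - 1) / z.

Lemma expmean_mult (z : R) : z * expmean z = exp z - 1.
Proof.
  unfold expmean; destruct (Req_EM_T z 0) as [-> | Hz].
  - rewrite exp_0; ring.
  - now field.
Qed.

Lemma expmean_0 : expmean 0 = 1.
Proof. unfold expmean; now destruct (Req_EM_T 0 0). Qed.

Lemma expmean_ge_1 (z : R) : 0 <= z -> 1 <= expmean z.
Proof.
  intros Hz; destruct (Req_dec z 0) as [-> | H0]; [rewrite expmean_0; lra | ].
  assert (H := expmean_mult z); assert (H1 := exp_ineq1_le z).
  nra.
Qed.

Lemma expmean_ge_exp (z : R) : z <= 0 -> exp z <= expmean z.
Proof.
  intros Hz; destruct (Req_dec z 0) as [-> | H0].
  { rewrite expmean_0, exp_0; lra. }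
  assert (H := expmean_mult z).
  assert (H1 := exp_ineq1_le (- z)).
  rewrite exp_Ropp in H1.
  assert (H2 := exp_pos z).
  assert (H3 : (1 - z) * exp z <= 1).
  { apply Rmult_le_reg_r with (/ exp z); [now apply Rinv_0_lt_compat | ].
    rewrite Rmult_assoc, Rinv_r; lra. }
  nra.
Qed.

Lemma expmean_pos (z : R) : 0 < expmean z.
Proof.
  destruct (Rle_dec 0 z).
  - generalize (expmean_ge_1 z r); lra.
  - generalize (expmean_ge_exp z ltac:(lra)), (exp_pos z); lra.
Qed.

Lemma is_derive_exp_real (z : R) : is_derive exp z (exp z).
Proof. apply is_derive_Reals, derivable_pt_lim_exp. Qed.

Lemma continuous_expmean (z : R) : continuous expmean z.
Proof.
  destruct (Req_dec z 0) as [-> | Hz].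
  - assert (H := proj1 (is_derive_quotient _ _ _) (is_derive_exp_real 0)).
    rewrite exp_0 in H.
    intros P HP; rewrite expmean_0 in HP.
    destruct (H P HP) as [d Hd].
    exists d; intros y Hy.
    unfold expmean; destruct (Req_EM_T y 0) as [-> | Hy0].
    + now apply locally_singleton.
    + specialize (Hd y Hy Hy0); simpl in Hd.
      now rewrite Rminus_0_r in Hd.
  - apply (continuous_ext_loc _ (fun z => (exp z - 1) / z)).
    + exists (mkposreal _ (Rabs_pos_lt _ Hz)); intros y Hy.
      unfold expmean; destruct (Req_EM_T y 0) as [-> | Hy0]; [ | easy].
      exfalso; change (Rabs (0 - z) < Rabs z) in Hy.
      rewrite Rminus_0_l, Rabs_Ropp in Hy; lra.
    + apply (continuous_of_is_derive _ _ ((exp z * z - (exp z - 1)) / z ^ 2)).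
      auto_derive; [easy | now field].
Qed.

(** The solution is sought as [M * exp (- w ^ 2 / 2)]; its slope is then
    [- slope_at p w], whatever the amplitude M. *)
Definition slope_at (p w : R) : R := w * sqrt (expmean ((p - 1) * w ^ 2)).

(** dx / dw for the solution of amplitude 1. *)
Definition density (p w : R) : R :=
  exp (- w ^ 2 / 2) / sqrt (expmean ((p - 1) * w ^ 2)).

Lemma sqrt_expmean_pos (z : R) : 0 < sqrt (expmean z).
Proof. apply sqrt_lt_R0, expmean_pos. Qed.

Lemma density_pos (p w : R) : 0 < density p w.
Proof. apply Rdiv_lt_0_compat; [apply exp_pos | apply sqrt_expmean_pos]. Qed.

Lemma continuous_sqrt_expmean (p w : R) :
  continuous (fun w => sqrt (expmean ((p - 1) * w ^ 2))) w.
Proof.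
  apply (continuous_comp (fun w => expmean ((p - 1) * w ^ 2)) sqrt).
  - apply (continuous_comp (fun w => (p - 1) * w ^ 2) expmean).
    + eapply continuous_of_is_derive; auto_derive; [easy | reflexivity].
    + apply continuous_expmean.
  - apply continuous_sqrt.
Qed.

Lemma continuous_density (p w : R) : continuous (density p) w.
Proof.
  unfold density.
  apply (continuous_mult (K := R_AbsRing)).
  - eapply continuous_of_is_derive; auto_derive; [easy | reflexivity].
  - apply continuous_Rinv_comp; [apply continuous_sqrt_expmean | ].
    generalize (sqrt_expmean_pos ((p - 1) * w ^ 2)); lra.
Qed.

(** First integral of (g^p)'' = - p g^(p-2): the right-hand side plus 1 is
    (M / g)^(2p-2) for g = M exp(-w^2/2). *)
Lemma slope_at_sqr (p w : R) : (p - 1) * slope_at p w ^ 2 = exp ((p - 1) * w ^ 2) - 1.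
Proof.
  unfold slope_at; rewrite Rpow_mult_distr, pow2_sqrt.
  - rewrite <- expmean_mult; ring.
  - apply Rlt_le, expmean_pos.
Qed.

Lemma slope_at_opp (p w : R) : slope_at p (- w) = - slope_at p w.
Proof.
  unfold slope_at; replace ((- w) ^ 2) with (w ^ 2) by ring; ring.
Qed.

Lemma slope_at_neg (p w : R) : w < 0 -> slope_at p w < 0.
Proof.
  intros Hw; unfold slope_at; generalize (sqrt_expmean_pos ((p - 1) * w ^ 2)); nra.
Qed.

(** This is dg/dw = - slope_at * dx/dw. *)
Lemma density_slope (p w : R) :
  density p w * slope_at p w = w * exp (- w ^ 2 / 2).
Proof.
  unfold density, slope_at; field.
  generalize (sqrt_expmean_pos ((p - 1) * w ^ 2)); lra.
Qed.

Lemma is_derive_slope_at (p w : R) :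
  is_derive (slope_at p) w
    (exp ((p - 1) * w ^ 2) / sqrt (expmean ((p - 1) * w ^ 2))).
Proof.
  destruct (Req_dec w 0) as [-> | Hw].
  { replace ((p - 1) * 0 ^ 2) with 0 by ring.
    replace (exp 0 / sqrt (expmean 0))
      with (sqrt (expmean ((p - 1) * 0 ^ 2))).
    2: { replace ((p - 1) * 0 ^ 2) with 0 by ring.
         rewrite expmean_0, exp_0, sqrt_1; field. }
    exact (is_derive_mult_at_0 (fun w => sqrt (expmean ((p - 1) * w ^ 2)))
             (continuous_sqrt_expmean p 0)). }
  destruct (Req_dec p 1) as [-> | Hp].
  { apply (is_derive_ext (fun w => w)).
    - intros v; unfold slope_at; rewrite Rminus_diag, Rmult_0_l, expmean_0, sqrt_1.
      symmetry; apply Rmult_1_r.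
    - rewrite Rminus_diag, Rmult_0_l, expmean_0, sqrt_1, exp_0.
      auto_derive; [easy | field]. }
  set (q := fun v => expmean ((p - 1) * v ^ 2)).
  assert (Hqv : forall v, v <> 0 ->
            (exp ((p - 1) * v ^ 2) - 1) / ((p - 1) * v ^ 2) = q v).
  { intros v Hv; unfold q; rewrite <- expmean_mult; field; split; [easy | lra]. }
  assert (Hq : is_derive q w (2 * (exp ((p - 1) * w ^ 2) - q w) / w)).
  { apply (is_derive_ext_loc
             (fun v => (exp ((p - 1) * v ^ 2) - 1) / ((p - 1) * v ^ 2))).
    - exists (mkposreal _ (Rabs_pos_lt _ Hw)); intros y Hy.
      apply Hqv; intros ->.
      change (Rabs (0 - w) < Rabs w) in Hy.
      rewrite Rminus_0_l, Rabs_Ropp in Hy; lra.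
    - rewrite <- (Hqv w Hw).
      auto_derive.
      + repeat apply Rmult_integral_contrapositive_currified; lra.
      + simpl; rewrite !Rmult_1_r; field; lra. }
  assert (Hq0 : 0 < q w) by apply expmean_pos.
  assert (Hs := sqrt_lt_R0 _ Hq0).
  assert (Hs2 := sqrt_sqrt _ (Rlt_le _ _ Hq0)).
  evar_last.
  - apply (is_derive_Rmult (fun v => v) (fun v => sqrt (q v)) w).
    + exact (is_derive_id w).
    + apply (is_derive_Rcomp sqrt q w); [ | exact Hq].
      apply is_derive_Reals, derivable_pt_lim_sqrt, Hq0.
  - unfold one; simpl.
    change (expmean ((p - 1) * (w * (w * 1)))) with (q w).
    apply Rmult_eq_reg_r with (sqrt (q w)); [ | lra].
    field_simplify; [ | lra | lra].
    rewrite pow2_sqrt; [simpl; field | lra].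
Qed.

Lemma density_opp (p w : R) : density p (- w) = density p w.
Proof. unfold density; now replace ((- w) ^ 2) with (w ^ 2) by ring. Qed.

(** For p >= 1 the square root in [density] is at least 1. For p < 1 it tends to 0
    at infinity, but the mean of [exp] over [z, 0] is at least [exp z], and this
    leaves the rate p > 0 of Gaussian decay. *)
Lemma density_le (p w : R) :
  density p w <= exp (- (Rmin p 1) * w ^ 2 / 2).
Proof.
  unfold density.
  set (z := (p - 1) * w ^ 2).
  assert (Hs := sqrt_expmean_pos z).
  apply Rmult_le_reg_r with (sqrt (expmean z)); [exact Hs | ].
  unfold Rdiv at 1; rewrite Rmult_assoc, Rinv_l, Rmult_1_r by lra.
  assert (Hw := pow2_ge_0 w).
  destruct (Rle_dec p 1) as [Hp | Hp].
  - rewrite Rmin_left by exact Hp.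
    replace (- w ^ 2 / 2) with (- p * w ^ 2 / 2 + z / 2) by (unfold z; field).
    rewrite exp_plus.
    apply Rmult_le_compat_l; [apply Rlt_le, exp_pos | ].
    rewrite <- (sqrt_pow2 (exp (z / 2))) by apply Rlt_le, exp_pos.
    apply sqrt_le_1_alt.
    replace (exp (z / 2) ^ 2) with (exp z).
    2: { simpl; rewrite Rmult_1_r, <- exp_plus; f_equal; field. }
    apply expmean_ge_exp; unfold z; nra.
  - rewrite Rmin_right by lra.
    rewrite <- (Rmult_1_r (exp (- w ^ 2 / 2))).
    replace (- (1) * w ^ 2 / 2) with (- w ^ 2 / 2) by field.
    apply Rmult_le_compat_l; [apply Rlt_le, exp_pos | ].
    rewrite <- sqrt_1; apply sqrt_le_1_alt, expmean_ge_1; unfold z; nra.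
Qed.

(** * Position as a function of the parameter, and its inverse *)

(** Place where the parameter is w on the solution of amplitude 1 whose maximum
    is at 0. *)
Definition position (p w : R) : R := RInt (density p) 0 w.

Lemma is_derive_position (p w : R) : is_derive (position p) w (density p w).
Proof.
  apply (is_derive_RInt (V := R_NormedModule) (density p) (position p) 0 w).
  - exists (mkposreal 1 Rlt_0_1); intros v _.
    apply (RInt_correct (V := R_CompleteNormedModule)).
    apply (ex_RInt_continuous (V := R_CompleteNormedModule)).
    intros x _; apply continuous_density.
  - apply continuous_density.
Qed.

Lemma continuous_position (p w : R) : continuous (position p) w.
Proof. exact (continuous_of_is_derive _ _ _ (is_derive_position p w)). Qed.

Lemma position_0 (p : R) : position p 0 = 0.
Proof. exact (RInt_point 0 (density p)). Qed.

Lemma position_incr (p v w : R) : v < w -> position p v < position p w.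
Proof.
  intros H.
  destruct (mean_value_open (position p) (density p) v w H) as [c [_ Hc]].
  - intros x _; apply is_derive_position.
  - intros x _; apply continuous_position.
  - generalize (density_pos p c); nra.
Qed.

Lemma position_le_iff (p v w : R) : position p v <= position p w <-> v <= w.
Proof.
  split; intros H.
  - destruct (Rle_dec v w) as [ | Hn]; [easy | ].
    generalize (position_incr p w v ltac:(lra)); lra.
  - destruct H as [H | ->]; [ | lra].
    now apply Rlt_le, position_incr.
Qed.

Lemma position_opp (p w : R) : position p (- w) = - position p w.
Proof.
  assert (H : forall v, 0 <= v -> position p (- v) = - position p v).
  { intros v Hv.
    assert (H := constant_of_derive_0
                   (fun x => position p x + position p (- x)) 0 v Hv).
    simpl in H; rewrite Ropp_0, position_0 in H.
    rewrite <- (Rplus_0_r (- position p v)).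
    replace 0 with (position p v + position p (- v)); [ring | ].
    rewrite <- H; [ring | intros x _].
    evar_last.
    - apply is_derive_Rplus.
      + apply is_derive_position.
      + apply (is_derive_Rcomp (position p) (fun x => - x)).
        * apply is_derive_position.
        * auto_derive; [easy | reflexivity].
    - rewrite density_opp; ring. }
  destruct (Rle_dec 0 w); [now apply H | ].
  rewrite <- (Ropp_involutive w) at 2.
  rewrite (H (- w)); lra.
Qed.

(** Comparison with an exponential, whose integral is explicit. *)
Lemma position_bounded (p : R) :
  0 < p -> exists B, forall w, position p w <= B.
Proof.
  intros Hp.
  set (m := Rmin p 1).
  assert (Hm : 0 < m) by (apply Rmin_glb_lt; lra).
  set (B := exp (/ (2 * m))).
  exists B; intros w.
  assert (HB := exp_pos (/ (2 * m))); fold B in HB.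
  destruct (Rle_dec w 0) as [Hw | Hw].
  { apply (position_le_iff p) in Hw; rewrite position_0 in Hw; lra. }
  destruct (mean_value_open (fun v => position p v + B * exp (- v))
              (fun v => density p v - B * exp (- v)) 0 w) as [c [_ Hc]].
  - lra.
  - intros x _.
    evar_last.
    + apply is_derive_Rplus; [apply is_derive_position | ].
      auto_derive; [easy | reflexivity].
    + ring.
  - intros x _.
    apply (continuous_plus (K := R_AbsRing) (V := R_NormedModule)).
    + apply continuous_position.
    + eapply continuous_of_is_derive; auto_derive; [easy | reflexivity].
  - rewrite position_0, Ropp_0, exp_0 in Hc.
    assert (Hd : density p c <= B * exp (- c)).
    { apply Rle_trans with (1 := density_le p c); fold m.
      unfold B; rewrite <- exp_plus.
      apply exp_le_mono.
      (* completing the square: m c^2 / 2 - c + 1 / (2 m) >= 0 *)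
      assert (Hsq : 0 <= (m * c - 1) ^ 2 / (2 * m)).
      { apply Rdiv_le_0_compat; [apply pow2_ge_0 | lra]. }
      replace ((m * c - 1) ^ 2 / (2 * m))
        with (m * c ^ 2 / 2 - c + / (2 * m)) in Hsq by (field; lra).
      lra. }
    generalize (exp_pos (- w)); nra.
Qed.

(** Half of the length of the interval on which the solution of amplitude 1 is
    positive. *)
Definition halfwidth (p : R) : R :=
  real (Lub_Rbar (fun z => exists w, z = position p w)).

Lemma halfwidth_is_lub (p : R) :
  0 < p -> is_lub (fun z => exists w, z = position p w) (halfwidth p).
Proof.
  intros Hp.
  destruct (position_bounded p Hp) as [B HB].
  destruct (completeness (fun z => exists w, z = position p w)) as [l Hl].
  - exists B; intros z [w ->]; apply HB.
  - exists (position p 0); now exists 0.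
  - unfold halfwidth.
    rewrite (is_lub_Rbar_unique _ (Finite l)); [exact Hl | ].
    destruct Hl as [H1 H2]; split.
    + intros z Hz; exact (H1 z Hz).
    + intros [b | | ] Hb; simpl; [ | easy | ].
      * apply H2; intros z Hz; exact (Hb z Hz).
      * exact (Hb _ (ex_intro _ 0 eq_refl)).
Qed.

Lemma position_lt_halfwidth (p w : R) : 0 < p -> position p w < halfwidth p.
Proof.
  intros Hp; apply Rlt_le_trans with (position p (w + 1)).
  - apply position_incr; lra.
  - apply halfwidth_is_lub; [easy | now exists (w + 1)].
Qed.

Lemma position_gt_opp_halfwidth (p w : R) : 0 < p -> - halfwidth p < position p w.
Proof.
  intros Hp; generalize (position_lt_halfwidth p (- w) Hp).
  rewrite position_opp; lra.
Qed.

Lemma halfwidth_pos (p : R) : 0 < p -> 0 < halfwidth p.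
Proof.
  intros Hp; rewrite <- (position_0 p); now apply position_lt_halfwidth.
Qed.

Lemma halfwidth_approx (p z : R) :
  0 < p -> z < halfwidth p -> exists w, z < position p w.
Proof.
  intros Hp Hz.
  apply Classical_Prop.NNPP; intros Hn.
  apply (Rlt_not_le _ _ Hz), (halfwidth_is_lub p Hp).
  intros v [w ->].
  destruct (Rle_dec (position p w) z) as [ | Hw]; [easy | ].
  exfalso; apply Hn; exists w; lra.
Qed.

Lemma position_surjective (p z : R) :
  0 < p -> - halfwidth p < z < halfwidth p -> exists w, position p w = z.
Proof.
  intros Hp Hz.
  destruct (halfwidth_approx p z Hp) as [b Hb]; [easy | ].
  destruct (halfwidth_approx p (- z) Hp) as [a Ha]; [lra | ].
  assert (Ha' : position p (- a) < z) by (rewrite position_opp; lra).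
  destruct (IVT_gen (position p) (- a) b z) as [w [_ Hw]].
  - intros w; apply continuity_pt_filterlim, continuous_position.
  - rewrite Rmin_left, Rmax_right; lra.
  - now exists w.
Qed.

Lemma is_lim_position (p : R) : 0 < p -> is_lim (position p) p_infty (halfwidth p).
Proof.
  intros Hp P [d Hd].
  destruct (halfwidth_approx p (halfwidth p - d) Hp) as [w Hw].
  { generalize (cond_pos d); lra. }
  exists w; intros v Hv.
  apply Hd.
  change (Rabs (position p v - halfwidth p) < d).
  assert (H1 := position_lt_halfwidth p v Hp).
  assert (H2 := position_incr p w v Hv).
  rewrite Rabs_left; lra.
Qed.

(** The inverse of [position p]. *)
Definition param (p z : R) : R := real (Lub_Rbar (fun w => position p w <= z)).

Lemma param_position (p w : R) : param p (position p w) = w.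
Proof.
  unfold param.
  rewrite (is_lub_Rbar_unique _ (Finite w)); [easy | split].
  - intros v Hv; now apply (position_le_iff p).
  - intros b Hb; apply Hb; lra.
Qed.

Lemma position_param (p z : R) :
  0 < p -> - halfwidth p < z < halfwidth p -> position p (param p z) = z.
Proof.
  intros Hp Hz.
  destruct (position_surjective p z Hp Hz) as [w <-].
  now rewrite param_position.
Qed.

Lemma param_opp (p z : R) :
  0 < p -> - halfwidth p < z < halfwidth p -> param p (- z) = - param p z.
Proof.
  intros Hp Hz.
  destruct (position_surjective p z Hp Hz) as [w <-].
  now rewrite <- position_opp, !param_position.
Qed.

Lemma param_lt (p y z : R) :
  0 < p -> - halfwidth p < y -> y < z -> z < halfwidth p -> param p y < param p z.
Proof.
  intros Hp Hy Hyz Hz.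
  destruct (position_surjective p y Hp ltac:(lra)) as [v <-].
  destruct (position_surjective p z Hp ltac:(lra)) as [w <-].
  rewrite !param_position.
  destruct (Rle_dec w v) as [H | H]; [ | lra].
  apply (position_le_iff p) in H; lra.
Qed.

Lemma continuous_param (p z : R) :
  0 < p -> - halfwidth p < z < halfwidth p -> continuous (param p) z.
Proof.
  intros Hp Hz P [d Hd].
  set (w := param p z) in *.
  assert (Hw : position p w = z) by now apply position_param.
  assert (d0 := cond_pos d).
  assert (H1 := position_incr p (w - d) w ltac:(lra)).
  assert (H2 := position_incr p w (w + d) ltac:(lra)).
  apply (locally_of_interval (position p (w - d)) (position p (w + d))); [lra | ].
  intros y Hy; apply Hd.
  destruct (position_surjective p y Hp) as [v Hv].
  { generalize (position_gt_opp_halfwidth p (w - d) Hp).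
    generalize (position_lt_halfwidth p (w + d) Hp); lra. }
  subst y; rewrite param_position.
  change (Rabs (v - w) < d).
  apply Rabs_def1.
  - apply Rnot_le_lt; intros H.
    apply (Rlt_not_le _ _ (proj2 Hy)), position_le_iff; lra.
  - apply Rnot_le_lt; intros H.
    apply (Rlt_not_le _ _ (proj1 Hy)), position_le_iff; lra.
Qed.

Lemma is_derive_param (p z : R) :
  0 < p -> - halfwidth p < z < halfwidth p ->
  is_derive (param p) z (/ density p (param p z)).
Proof.
  intros Hp Hz.
  apply (is_derive_inverse (position p)).
  - apply is_derive_position.
  - generalize (density_pos p (param p z)); lra.
  - now apply continuous_param.
  - apply (locally_of_interval _ _ _ _ Hz).
    intros y Hy; now apply position_param.
Qed.

Lemma param_at_left_end (p : R) :
  0 < p -> filterlim (param p) (at_right (- halfwidth p)) (Rbar_locally m_infty).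
Proof.
  intros Hp P [a Ha].
  assert (H1 := position_gt_opp_halfwidth p a Hp).
  assert (H2 := position_lt_halfwidth p a Hp).
  assert (Hd : 0 < position p a + halfwidth p) by lra.
  exists (mkposreal _ Hd); intros y Hy Hlt.
  change (Rabs (y - - halfwidth p) < position p a + halfwidth p) in Hy.
  rewrite Rabs_pos_eq in Hy by lra.
  apply Ha.
  rewrite <- (param_position p a).
  apply param_lt; lra.
Qed.

(** The solution of amplitude 1, centred at its maximum, extended by 0. *)
Definition profile (p z : R) : R :=
  if Rlt_dec (Rabs z) (halfwidth p) then exp (- param p z ^ 2 / 2) else 0.

Lemma profile_in (p z : R) :
  - halfwidth p < z < halfwidth p -> profile p z = exp (- param p z ^ 2 / 2).
Proof.
  intros Hz; unfold profile.
  destruct (Rlt_dec (Rabs z) (halfwidth p)) as [ | H]; [easy | ].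
  exfalso; apply H; now apply Rabs_def1.
Qed.

Lemma profile_out (p z : R) : halfwidth p <= Rabs z -> profile p z = 0.
Proof.
  intros Hz; unfold profile.
  destruct (Rlt_dec (Rabs z) (halfwidth p)); [lra | easy].
Qed.

Lemma profile_bounds (p z : R) : 0 <= profile p z <= 1.
Proof.
  unfold profile; destruct (Rlt_dec (Rabs z) (halfwidth p)); [ | lra].
  split; [apply Rlt_le, exp_pos | ].
  rewrite <- exp_0; apply exp_le_mono.
  generalize (pow2_ge_0 (param p z)); lra.
Qed.

Lemma profile_opp (p z : R) : 0 < p -> profile p (- z) = profile p z.
Proof.
  intros Hp; unfold profile; rewrite Rabs_Ropp.
  destruct (Rlt_dec (Rabs z) (halfwidth p)) as [H | ]; [ | easy].
  apply Rabs_def2 in H.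
  rewrite param_opp by (tauto || lra).
  now replace ((- param p z) ^ 2) with (param p z ^ 2) by ring.
Qed.

(** Far from the centre the parameter is large: this is the continuity of the
    profile at the ends of its support. *)
Lemma profile_small (p a z : R) :
  0 < p -> 0 <= a -> position p a <= Rabs z -> profile p z <= exp (- a ^ 2 / 2).
Proof.
  intros Hp Ha Hz.
  assert (H : forall y, 0 <= y -> position p a <= y -> profile p y <= exp (- a ^ 2 / 2)).
  { intros y Hy Hay.
    assert (Hl := halfwidth_pos p Hp).
    destruct (Rlt_dec y (halfwidth p)) as [Hlt | Hge].
    - rewrite profile_in by lra.
      rewrite <- (position_param p y Hp) in Hay by lra.
      apply position_le_iff in Hay.
      apply exp_le_mono.
      generalize (pow_incr a (param p y) 2); lra.
    - rewrite profile_out; [apply Rlt_le, exp_pos | ].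
      rewrite Rabs_pos_eq; lra. }
  destruct (Rle_dec 0 z).
  - rewrite Rabs_pos_eq in Hz by easy; now apply H.
  - rewrite Rabs_left in Hz by lra.
    rewrite <- profile_opp by easy; apply H; lra.
Qed.

(** Chain rule for the change of variable dx = M * density * dw. *)
Lemma is_derive_along (p M c x : R) (F : R -> R) (d : R) :
  0 < p -> 0 < M -> - halfwidth p < (x - c) / M < halfwidth p ->
  is_derive F (param p ((x - c) / M)) d ->
  is_derive (fun y => F (param p ((y - c) / M))) x
    (d / (M * density p (param p ((x - c) / M)))).
Proof.
  intros Hp HM Hx HF.
  evar_last.
  - apply (is_derive_Rcomp F (fun y => param p ((y - c) / M))); [exact HF | ].
    apply (is_derive_Rcomp (param p) (fun y => (y - c) / M)).
    + now apply is_derive_param.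
    + auto_derive; [easy | reflexivity].
  - simpl; field; split; [ | lra].
    generalize (density_pos p (param p ((x - c) / M))); lra.
Qed.

Lemma locally_profile_domain (p M c x : R) :
  0 < M -> - halfwidth p < (x - c) / M < halfwidth p ->
  locally x (fun y => - halfwidth p < (y - c) / M < halfwidth p).
Proof.
  intros HM Hx.
  apply (locally_of_interval (c - M * halfwidth p) (c + M * halfwidth p)).
  - replace x with (c + M * ((x - c) / M)) by (field; lra); nra.
  - intros y Hy; split.
    + apply Rmult_lt_reg_l with M; [easy | ].
      replace (M * ((y - c) / M)) with (y - c) by (field; lra); lra.
    + apply Rmult_lt_reg_l with M; [easy | ].
      replace (M * ((y - c) / M)) with (y - c) by (field; lra); lra.
Qed.

Lemma is_derive_profile (p M c x : R) :
  0 < p -> 0 < M -> - halfwidth p < (x - c) / M < halfwidth p ->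
  is_derive (fun y => M * profile p ((y - c) / M)) x
    (- slope_at p (param p ((x - c) / M))).
Proof.
  intros Hp HM Hx.
  apply (is_derive_ext_loc (fun y => M * exp (- param p ((y - c) / M) ^ 2 / 2))).
  - refine (locally_imp2 _ _ _ _ _ (locally_profile_domain p M c x HM Hx)
              (locally_profile_domain p M c x HM Hx)).
    intros y Hy _; now rewrite profile_in.
  - set (w := param p ((x - c) / M)).
    evar_last.
    + apply (is_derive_along p M c x (fun w => M * exp (- w ^ 2 / 2))); [easy .. | ].
      auto_derive; [easy | reflexivity].
    + fold w; assert (Hd := density_pos p w).
      apply Rmult_eq_reg_r with (M * density p w); [ | nra].
      replace (- slope_at p w * (M * density p w))
        with (- M * (density p w * slope_at p w)) by ring.
      rewrite density_slope; simpl; unfold Rdiv; field; lra.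
Qed.

Lemma continuous_profile (p z : R) : 0 < p -> continuous (profile p) z.
Proof.
  intros Hp.
  destruct (Rlt_dec (Rabs z) (halfwidth p)) as [Hz | Hz].
  { apply Rabs_def2 in Hz.
    assert (H := is_derive_profile p 1 0 z Hp Rlt_0_1).
    replace ((z - 0) / 1) with z in H by field.
    specialize (H ltac:(lra)).
    apply continuous_of_is_derive in H.
    apply (continuous_ext (fun y => 1 * profile p ((y - 0) / 1))); [ | exact H].
    intros y; simpl; rewrite Rmult_1_l, Rminus_0_r, Rdiv_1_r; easy. }
  intros P [d Hd].
  rewrite profile_out in Hd by lra.
  (* large enough for exp (- a^2 / 2) < d *)
  set (a := 1 + 2 * Rabs (ln d)).
  assert (Hln := Rabs_pos (ln d)).
  assert (Ha : exp (- a ^ 2 / 2) < d).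
  { rewrite <- (exp_ln d) by apply cond_pos.
    apply exp_increasing.
    generalize (Rle_abs (- ln d)); rewrite Rabs_Ropp; unfold a; nra. }
  assert (Hpa : position p a < Rabs z).
  { generalize (position_lt_halfwidth p a Hp); lra. }
  assert (He : 0 < Rabs z - position p a) by lra.
  exists (mkposreal _ He); intros y Hy.
  apply Hd.
  change (Rabs (profile p y - 0) < d).
  change (Rabs (y - z) < Rabs z - position p a) in Hy.
  rewrite Rminus_0_r, Rabs_pos_eq by apply profile_bounds.
  apply Rle_lt_trans with (2 := Ha).
  apply profile_small; [easy | unfold a; lra | ].
  generalize (Rabs_triang_inv z y); rewrite Rabs_minus_sym; lra.
Qed.

(** Slope of the profile at the left end of its support. *)
Definition end_slope (p : R) : Rbar :=
  if Rlt_dec p 1 then Finite (1 / sqrt (1 - p)) else p_infty.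

Lemma slope_at_lim (p : R) :
  filterlim (fun w => - slope_at p w) (Rbar_locally m_infty)
    (Rbar_locally (end_slope p)).
Proof.
  unfold end_slope; destruct (Rlt_dec p 1) as [Hp | Hp].
  - apply (filterlim_ext_loc (fun w => sqrt ((1 - exp ((p - 1) * w ^ 2)) / (1 - p)))).
    { exists 0; intros w Hw.
      replace ((1 - exp ((p - 1) * w ^ 2)) / (1 - p)) with ((- slope_at p w) ^ 2).
      - apply sqrt_pow2; generalize (slope_at_neg p w Hw); lra.
      - replace (exp ((p - 1) * w ^ 2)) with (1 + (p - 1) * slope_at p w ^ 2)
          by (rewrite slope_at_sqr; ring).
        field; lra. }
    assert (H1 : filterlim (fun w => (p - 1) * w ^ 2) (Rbar_locally m_infty)
                   (Rbar_locally m_infty)).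
    { intros P [m Hm].
      set (n := 1 + Rabs m / (1 - p)).
      assert (Hn : 0 <= Rabs m / (1 - p)).
      { apply Rdiv_le_0_compat; [apply Rabs_pos | lra]. }
      exists (- n); intros w Hw; apply Hm.
      apply Rlt_le_trans with (- ((1 - p) * n)).
      - assert (n < w ^ 2) by (unfold n in *; nra); nra.
      - replace ((1 - p) * n) with ((1 - p) + Rabs m) by (unfold n; field; lra).
        generalize (Rle_abs (- m)); rewrite Rabs_Ropp; lra. }
    assert (H2 := filterlim_comp _ _ _ _ _ _ _ _ H1 is_lim_exp_m).
    assert (H3 : continuous (fun v => sqrt ((1 - v) / (1 - p))) 0).
    { apply (continuous_comp (fun v => (1 - v) / (1 - p)) sqrt).
      - eapply continuous_of_is_derive; auto_derive; [lra | reflexivity].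
      - apply continuous_sqrt. }
    unfold continuous in H3.
    replace (sqrt ((1 - 0) / (1 - p))) with (1 / sqrt (1 - p)) in H3.
    { exact (filterlim_comp _ _ _ _ _ _ _ _ H2 H3). }
    rewrite Rminus_0_r, sqrt_div, sqrt_1 by lra; easy.
  - intros P [m Hm].
    exists (Rmin 0 (- m)); intros w Hw; apply Hm.
    assert (H1 := Rmin_l 0 (- m)).
    assert (H2 := Rmin_r 0 (- m)).
    assert (H3 : 1 <= sqrt (expmean ((p - 1) * w ^ 2))).
    { rewrite <- sqrt_1 at 1; apply sqrt_le_1_alt, expmean_ge_1.
      generalize (pow2_ge_0 w); nra. }
    unfold slope_at; nra.
Qed.

(** * The constant and the amplitude *)

(** The constant C for which the largest value of the solution at time 0 is M. *)
Definition constant_of_amplitude (p M : R) : R :=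
  if Req_EM_T p 1 then - 2 * ln M
  else p ^ 2 / Rabs (p - 1) * Rpower M (2 * p - 2).

(** A value is written as [M * exp (- q / 2)], where q < 0 is allowed so as to
    cover the values above the amplitude. *)
Lemma radicand_value (p M t q : R) :
  0 < p -> 0 < M -> t < 1 ->
  radicand p (constant_of_amplitude p M) t (M * exp (- q / 2) / sqrt (1 - t)) =
  Finite (p ^ 2 * (q * expmean ((p - 1) * q))).
Proof.
  intros Hp HM Ht.
  assert (Hs := sqrt_lt_R0 (1 - t) ltac:(lra)).
  assert (Hv : 0 < M * exp (- q / 2) / sqrt (1 - t)).
  { apply Rdiv_lt_0_compat; [ | easy].
    apply Rmult_lt_0_compat; [easy | apply exp_pos]. }
  assert (Hln : ln (M * exp (- q / 2) / sqrt (1 - t)) =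
                ln M - q / 2 - ln (1 - t) / 2).
  { assert (He := exp_pos (- q / 2)).
    rewrite ln_div, ln_mult, ln_exp by (easy || nra).
    rewrite <- (sqrt_sqrt (1 - t)) at 2 by lra.
    rewrite ln_mult by easy; field. }
  assert (Hpow : p <> 1 -> constant_of_amplitude p M * Rpower (1 - t) (1 - p) *
                 rpow (M * exp (- q / 2) / sqrt (1 - t)) (2 - 2 * p) =
                 p ^ 2 / Rabs (p - 1) * exp ((p - 1) * q)).
  { intros Hp1; unfold constant_of_amplitude, rpow.
    destruct (Req_EM_T p 1); [easy | ].
    destruct (Rlt_dec 0 (M * exp (- q / 2) / sqrt (1 - t))); [ | easy].
    unfold Rpower; rewrite Hln, !Rmult_assoc, <- !exp_plus.
    do 2 f_equal; field. }
  assert (Hq : p <> 1 -> q * expmean ((p - 1) * q) = (exp ((p - 1) * q) - 1) / (p - 1)).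
  { intros Hp1; rewrite <- expmean_mult; field; lra. }
  unfold radicand.
  destruct (Rlt_dec p 1) as [Hlt | Hge].
  - rewrite Hpow, Hq, Rabs_left by lra.
    f_equal; field; lra.
  - destruct (Req_EM_T (M * exp (- q / 2) / sqrt (1 - t)) 0); [lra | ].
    destruct (Req_EM_T p 1) as [-> | Hne].
    + rewrite Hln, Rminus_diag, Rmult_0_l, expmean_0.
      unfold constant_of_amplitude; destruct (Req_EM_T 1 1); [ | easy].
      f_equal; field.
    + rewrite Hpow, Hq, Rabs_pos_eq by lra.
      f_equal; field; lra.
Qed.

(** The prescribed slope is that of the profile of amplitude M, rescaled by the
    factor 1 / sqrt (1 - t), for every value in ]0, M / sqrt (1 - t)]. *)
Lemma slope_value (p M t w : R) :
  0 < p -> 0 < M -> t < 1 ->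
  slope p (constant_of_amplitude p M) t (M * exp (- w ^ 2 / 2) / sqrt (1 - t)) =
  Finite (/ sqrt (1 - t) * Rabs (slope_at p w)).
Proof.
  intros Hp HM Ht.
  assert (Hs := sqrt_lt_R0 (1 - t) ltac:(lra)).
  unfold slope; rewrite radicand_value by easy.
  replace (p ^ 2 * (w ^ 2 * expmean ((p - 1) * w ^ 2))) with ((p * slope_at p w) ^ 2).
  - rewrite <- Rsqr_pow2; simpl; rewrite sqrt_Rsqr_abs, Rabs_mult, (Rabs_pos_eq p) by lra.
    f_equal; field; lra.
  - unfold slope_at; rewrite !Rpow_mult_distr, pow2_sqrt; [ring | ].
    apply Rlt_le, expmean_pos.
Qed.

Lemma slope_0 (p C t : R) :
  0 < p -> t < 1 -> slope p C t 0 = Rbar_mult (/ sqrt (1 - t)) (end_slope p).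
Proof.
  intros Hp Ht.
  assert (Hs := sqrt_lt_R0 (1 - t) ltac:(lra)).
  assert (Hps : 0 < p * sqrt (1 - t)) by nra.
  unfold slope, radicand, end_slope.
  destruct (Rlt_dec p 1) as [Hlt | Hge].
  - unfold rpow; destruct (Rlt_dec 0 0); [lra | ].
    assert (Hs1 := sqrt_lt_R0 (1 - p) ltac:(lra)).
    simpl; rewrite Rmult_0_r, Rminus_0_r, Rmult_1_r, sqrt_div by nra.
    rewrite sqrt_square by lra; f_equal; field; lra.
  - destruct (Req_EM_T 0 0); [ | easy].
    simpl Rbar_sqrt.
    rewrite !(Rbar_mult_comm (Finite _) p_infty).
    rewrite !(is_Rbar_mult_unique _ _ p_infty); [easy | | ].
    + apply is_Rbar_mult_p_infty_pos; simpl; now apply Rinv_0_lt_compat.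
    + apply is_Rbar_mult_p_infty_pos; simpl; apply Rdiv_lt_0_compat; lra.
Qed.

Lemma constant_of_amplitude_surjective (p C : R) :
  0 < p -> 0 < C -> exists M, 0 < M /\ constant_of_amplitude p M = C.
Proof.
  intros Hp HC; unfold constant_of_amplitude.
  destruct (Req_EM_T p 1) as [-> | Hne].
  - exists (exp (- C / 2)); split; [apply exp_pos | rewrite ln_exp; field].
  - assert (Ha := Rabs_pos_lt (p - 1) ltac:(lra)).
    assert (Hv : 0 < C * Rabs (p - 1) / p ^ 2).
    { apply Rdiv_lt_0_compat; [nra | apply pow_lt; lra]. }
    exists (Rpower (C * Rabs (p - 1) / p ^ 2) (/ (2 * p - 2))); split; [apply exp_pos | ].
    rewrite Rpower_mult, Rinv_l, Rpower_1 by (easy || lra).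
    field; lra.
Qed.

Lemma upper_bound_value (p M t : R) :
  0 < p -> 0 < M -> upper_bound p (constant_of_amplitude p M) t = / sqrt (1 - t) * M.
Proof.
  intros Hp HM; unfold upper_bound, constant_of_amplitude.
  replace (1 / sqrt (1 - t)) with (/ sqrt (1 - t)) by (unfold Rdiv; ring).
  f_equal.
  destruct (Req_EM_T p 1) as [-> | Hne].
  - replace (- (-2 * ln M) / 2) with (ln M) by field; now apply exp_ln.
  - assert (Ha := Rabs_pos_lt (p - 1) ltac:(lra)).
    replace (Rabs (2 * p - 2)) with (2 * Rabs (p - 1)).
    2: { rewrite <- (Rabs_pos_eq 2) at 1 by lra; rewrite <- Rabs_mult; f_equal; ring. }
    replace (2 * Rabs (p - 1) * (p ^ 2 / Rabs (p - 1) * Rpower M (2 * p - 2)) / (2 * p ^ 2))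
      with (Rpower M (2 * p - 2)) by (field; lra).
    rewrite Rpower_mult.
    replace ((2 * p - 2) * (1 / (2 * p - 2))) with 1 by (field; lra).
    now apply Rpower_1.
Qed.

(** * Existence *)

(** The amplitude of the solution whose interval of positivity has length 1. *)
Definition amplitude (p : R) : R := / (2 * halfwidth p).

Definition separated (p x : R) : R :=
  amplitude p * profile p ((x - 1 / 2) / amplitude p).

Definition solution (p t x : R) : R := / sqrt (1 - t) * separated p x.

Lemma amplitude_pos (p : R) : 0 < p -> 0 < amplitude p.
Proof.
  intros Hp; apply Rinv_0_lt_compat; generalize (halfwidth_pos p Hp); lra.
Qed.

Lemma amplitude_scaling (p x : R) :
  0 < p -> (x - 1 / 2) / amplitude p = (2 * x - 1) * halfwidth p.
Proof.
  intros Hp; unfold amplitude; generalize (halfwidth_pos p Hp); intros; field; lra.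
Qed.

Lemma unit_interval_domain (p x : R) :
  0 < p -> 0 < x < 1 ->
  - halfwidth p < (x - 1 / 2) / amplitude p < halfwidth p.
Proof.
  intros Hp Hx; rewrite amplitude_scaling by easy.
  generalize (halfwidth_pos p Hp); nra.
Qed.

Lemma separated_in (p x : R) :
  0 < p -> 0 < x < 1 ->
  separated p x =
  amplitude p * exp (- param p ((x - 1 / 2) / amplitude p) ^ 2 / 2).
Proof.
  intros Hp Hx; unfold separated.
  now rewrite profile_in by now apply unit_interval_domain.
Qed.

Lemma separated_0 (p : R) : 0 < p -> separated p 0 = 0.
Proof.
  intros Hp; unfold separated; rewrite amplitude_scaling, profile_out; [ring | | easy].
  generalize (halfwidth_pos p Hp); intros.
  rewrite Rabs_left; lra.
Qed.

Lemma separated_reflect (p x : R) : 0 < p -> separated p (1 - x) = separated p x.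
Proof.
  intros Hp; unfold separated; rewrite !amplitude_scaling by easy.
  replace ((2 * (1 - x) - 1) * halfwidth p) with (- ((2 * x - 1) * halfwidth p)) by ring.
  now rewrite profile_opp.
Qed.

Lemma continuous_separated (p x : R) : 0 < p -> continuous (separated p) x.
Proof.
  intros Hp; unfold separated.
  apply (continuous_mult (K := R_AbsRing) (fun _ => amplitude p)).
  - apply continuous_const.
  - apply (continuous_comp (fun x => (x - 1 / 2) / amplitude p) (profile p)).
    + eapply continuous_of_is_derive; auto_derive; [easy | reflexivity].
    + now apply continuous_profile.
Qed.

Lemma is_derive_separated (p x : R) :
  0 < p -> 0 < x < 1 ->
  is_derive (separated p) x (- slope_at p (param p ((x - 1 / 2) / amplitude p))).
Proof.
  intros Hp Hx; apply is_derive_profile; [easy | now apply amplitude_pos | ].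
  now apply unit_interval_domain.
Qed.

(** As x tends to 0 the parameter tends to - infinity, and the derivative to the
    limit of the slope. *)
Lemma is_derive_in_separated_0 (p : R) :
  0 < p -> is_derive_in space (separated p) 0 (end_slope p).
Proof.
  intros Hp.
  apply (is_derive_in_right_limit _
           (fun x => - slope_at p (param p ((x - 1 / 2) / amplitude p))) _ 0 1).
  - lra.
  - intros x [Hx _]; exact Hx.
  - intros x; now apply continuous_separated.
  - intros x Hx; now apply is_derive_separated.
  - assert (HL := halfwidth_pos p Hp).
    assert (H : filterlim (fun x => (x - 1 / 2) / amplitude p) (at_right 0)
                  (at_right (- halfwidth p))).
    { intros P [d Hd].
      assert (He : 0 < d / (2 * halfwidth p)).
      { apply Rdiv_lt_0_compat; [apply cond_pos | lra]. }
      exists (mkposreal _ He); intros y Hy Hy0.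
      change (Rabs (y - 0) < d / (2 * halfwidth p)) in Hy.
      rewrite Rminus_0_r, Rabs_pos_eq in Hy by lra.
      rewrite amplitude_scaling by easy.
      apply (Rmult_lt_compat_r (2 * halfwidth p)) in Hy; [ | lra].
      replace (d / (2 * halfwidth p) * (2 * halfwidth p)) with (pos d) in Hy
        by (field; lra).
      apply Hd; [ | nra].
      change (Rabs ((2 * y - 1) * halfwidth p - - halfwidth p) < d).
      rewrite Rabs_pos_eq; nra. }
    exact (filterlim_comp _ _ _ _ _ _ _ _
             (filterlim_comp _ _ _ _ _ _ _ _ H (param_at_left_end p Hp))
             (slope_at_lim p)).
Qed.

Lemma solution_pos (p t x : R) : 0 < p -> time t -> 0 < x < 1 -> 0 < solution p t x.
Proof.
  intros Hp Ht Hx; unfold time in Ht.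
  apply Rmult_lt_0_compat.
  - apply Rinv_0_lt_compat, sqrt_lt_R0; lra.
  - rewrite separated_in by easy.
    apply Rmult_lt_0_compat; [now apply amplitude_pos | apply exp_pos].
Qed.

Lemma solution_gradient (p : R) :
  0 < p ->
  gradient_formula p (constant_of_amplitude p (amplitude p)) (solution p).
Proof.
  intros Hp t x Ht Hx; unfold time in Ht.
  assert (HM := amplitude_pos p Hp).
  assert (Hs := sqrt_lt_R0 (1 - t) ltac:(lra)).
  set (C := constant_of_amplitude p (amplitude p)).
  assert (Hrefl : forall y, solution p t (1 - y) = solution p t y).
  { intros y; unfold solution; now rewrite separated_reflect. }
  assert (Hmain : Rbar_le 0 (radicand p C t (solution p t x)) /\
                  is_derive_in space (solution p t) x (slope p C t (solution p t x))).
  { destruct (Rle_lt_or_eq_dec 0 x ltac:(lra)) as [Hx0 | <-].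
    - set (w := param p ((x - 1 / 2) / amplitude p)).
      assert (Hw : w <= 0).
      { assert (HL := halfwidth_pos p Hp).
        assert (Hd := unit_interval_domain p x Hp ltac:(lra)).
        apply (position_le_iff p); rewrite position_0.
        unfold w; rewrite position_param by easy.
        rewrite amplitude_scaling by easy; nra. }
      replace (solution p t x)
        with (amplitude p * exp (- w ^ 2 / 2) / sqrt (1 - t)).
      2: { unfold solution; rewrite separated_in by lra; fold w; field; lra. }
      unfold C; split.
      + rewrite radicand_value by (easy || lra); simpl.
        generalize (expmean_pos ((p - 1) * (w * (w * 1)))); intros.
        assert (0 <= w * (w * 1)) by nra.
        apply Rmult_le_pos; [nra | ].
        apply Rmult_le_pos; lra.
      + rewrite slope_value by (easy || lra).
        apply is_derive_in_of_is_derive.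
        replace (Rabs (slope_at p w)) with (- slope_at p w).
        2: { destruct Hw as [Hw | ->].
             - rewrite Rabs_left; [easy | now apply slope_at_neg].
             - unfold slope_at; rewrite Rmult_0_l, Rabs_R0; ring. }
        apply (is_derive_scal (separated p)).
        apply is_derive_separated; lra.
    - unfold solution; rewrite separated_0, Rmult_0_r by easy; split.
      + unfold radicand; destruct (Rlt_dec p 1).
        * unfold rpow; destruct (Rlt_dec 0 0); [lra | ].
          simpl; rewrite Rmult_0_r, Rminus_0_r.
          apply Rdiv_le_0_compat; nra.
        * destruct (Req_EM_T 0 0); [exact I | easy].
      + rewrite slope_0 by lra.
        now apply is_derive_in_scal, is_derive_in_separated_0. }
  split; [apply Hmain | split; [apply Hmain | ]].
  apply is_derive_in_reflect; [exact Hrefl | apply Hmain].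
Qed.

(** The three derivatives of [solution p t x ^ p] are products of a function of
    t and one of w = [param p ((x - 1 / 2) / amplitude p)]; the equation comes
    down to (g^p)'' = - p g^(p-2) for the spatial factor g. *)
Lemma solution_equation (p : R) :
  0 < p ->
  exists ut ux uxx : R -> R -> R,
    (forall v, v = ut \/ v = ux \/ v = uxx ->
       continuous_on (fun z : R * R => time (fst z) /\ 0 < snd z < 1)
                     (fun z : R * R => v (fst z) (snd z))) /\
    (forall t x, time t -> 0 < x < 1 ->
       is_derive_in time (fun s => rpow (solution p s x) p) t (ut t x) /\
       is_derive (fun y => rpow (solution p t y) p) x (ux t x) /\
       is_derive (fun y => ux t y) x (uxx t x) /\
       0 = ut t x + 1 / 2 * solution p t x ^ 2 * uxx t x).
Proof.
  intros Hp.
  assert (HM := amplitude_pos p Hp).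
  set (M := amplitude p) in *.
  set (W := fun x => param p ((x - 1 / 2) / M)).
  set (a := fun t => exp (- p / 2 * ln (1 - t))).
  set (V := fun w => exp (p * (ln M - w ^ 2 / 2))).
  set (V1 := fun w => - p * exp ((p - 1) * ln M) *
                      (slope_at p w * exp ((1 - p) * w ^ 2 / 2))).
  set (V2 := fun w => - p * exp ((p - 2) * (ln M - w ^ 2 / 2))).
  assert (HV : forall w, is_derive V w (M * density p w * V1 w)).
  { intros w; unfold V; auto_derive; [easy | ].
    unfold V1.
    replace (M * density p w * (- p * exp ((p - 1) * ln M) *
              (slope_at p w * exp ((1 - p) * w ^ 2 / 2))))
      with (- p * (M * (density p w * slope_at p w) *
              (exp ((p - 1) * ln M) * exp ((1 - p) * w ^ 2 / 2)))) by ring.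
    rewrite density_slope.
    rewrite <- (exp_ln M) at 2 by easy.
    replace (exp (ln M) * (w * exp (- w ^ 2 / 2)) *
             (exp ((p - 1) * ln M) * exp ((1 - p) * w ^ 2 / 2)))
      with (w * (exp (ln M) * exp (- w ^ 2 / 2) *
             (exp ((p - 1) * ln M) * exp ((1 - p) * w ^ 2 / 2)))) by ring.
    rewrite <- !exp_plus.
    replace (ln M + - w ^ 2 / 2 + ((p - 1) * ln M + (1 - p) * w ^ 2 / 2))
      with (p * (ln M + - (w * (w * 1) * / 2))) by (simpl; field).
    field. }
  assert (HV1 : forall w, is_derive V1 w (M * density p w * V2 w)).
  { intros w; unfold V1.
    set (z := (p - 1) * w ^ 2).
    assert (Hs := sqrt_expmean_pos z).
    evar_last.
    - apply (is_derive_scal (fun w => slope_at p w * exp ((1 - p) * w ^ 2 / 2))).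
      apply is_derive_Rmult; [apply is_derive_slope_at | ].
      auto_derive; [easy | reflexivity].
    - fold z; unfold V2.
      assert (Hz : slope_at p w * ((1 - p) * w) = (1 - exp z) / sqrt (expmean z)).
      { unfold slope_at; fold z.
        apply Rmult_eq_reg_r with (sqrt (expmean z)); [ | lra].
        replace (w * sqrt (expmean z) * ((1 - p) * w) * sqrt (expmean z))
          with (- (z * (sqrt (expmean z) * sqrt (expmean z)))) by (unfold z; ring).
        rewrite sqrt_sqrt, expmean_mult by apply Rlt_le, expmean_pos.
        field; lra. }
      transitivity (- p * exp ((p - 1) * ln M) *
                    (exp ((1 - p) * w ^ 2 / 2) / sqrt (expmean z))).
      + simpl.
        replace (exp ((1 - p) * (w * (w * 1)) * / 2)) with (exp ((1 - p) * w ^ 2 / 2))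
          by (f_equal; simpl; field).
        simpl in Hz |- *.
        match goal with |- context [slope_at p w * ?r] =>
          replace (slope_at p w * r) with
            (slope_at p w * ((1 - p) * w) * exp ((1 - p) * (w * (w * 1)) / 2)) by field end.
        rewrite Hz; field; lra.
      + unfold density; fold z.
        replace ((p - 1) * ln M) with (ln M + (p - 2) * ln M) by ring.
        replace ((1 - p) * w ^ 2 / 2) with (- w ^ 2 / 2 + (p - 2) * (- w ^ 2 / 2))
          by field.
        replace ((p - 2) * (ln M - w ^ 2 / 2))
          with ((p - 2) * ln M + (p - 2) * (- w ^ 2 / 2)) by field.
        rewrite !exp_plus, exp_ln by easy.
        field; lra. }
  assert (Hu : forall t x, time t -> 0 < x < 1 ->
                 rpow (solution p t x) p = a t * V (W x)).
  { intros t x Ht Hx; unfold time in Ht.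
    assert (Hpos := solution_pos p t x Hp Ht Hx).
    unfold rpow; destruct (Rlt_dec 0 (solution p t x)); [ | easy].
    assert (Hs := sqrt_lt_R0 (1 - t) ltac:(lra)).
    assert (He := exp_pos (- W x ^ 2 / 2)).
    unfold Rpower, a, V; rewrite <- exp_plus; f_equal.
    unfold solution; rewrite separated_in by easy; fold M (W x).
    rewrite ln_mult, ln_mult, ln_exp, ln_Rinv by (easy || nra || now apply Rinv_0_lt_compat).
    rewrite <- (sqrt_sqrt (1 - t)) at 2 by lra.
    rewrite ln_mult by easy; field. }
  assert (HW : forall F dF x, 0 < x < 1 ->
            (forall w, is_derive F w (M * density p w * dF w)) ->
            is_derive (fun y => F (W y)) x (dF (W x))).
  { intros F dF x Hx HF.
    evar_last.
    - apply (is_derive_along p M (1 / 2) x F); [easy | easy | | apply HF].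
      now apply unit_interval_domain.
    - fold (W x); generalize (density_pos p (W x)); intros; simpl; field; lra. }
  exists (fun t x => p / (2 * (1 - t)) * a t * V (W x)).
  exists (fun t x => a t * V1 (W x)).
  exists (fun t x => a t * V2 (W x)).
  assert (HcW : forall x, 0 < x < 1 -> continuous W x).
  { intros x Hx.
    apply (continuous_comp (fun x => (x - 1 / 2) / M) (param p)).
    - eapply continuous_of_is_derive; auto_derive; [easy | reflexivity].
    - apply continuous_param; [easy | now apply unit_interval_domain]. }
  assert (Hca : forall t, time t -> continuous a t).
  { intros t Ht; unfold time in Ht.
    eapply continuous_of_is_derive; unfold a; auto_derive; [lra | reflexivity]. }
  split.
  - intros v [-> | [-> | ->]].
    + apply (continuous_on_product (fun t => p / (2 * (1 - t)) * a t) (fun x => V (W x))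
               time (fun x => 0 < x < 1)).
      * intros t Ht; unfold time in Ht.
        eapply continuous_of_is_derive; unfold a; auto_derive; [split; lra | reflexivity].
      * intros x Hx; apply (continuous_comp W V); [now apply HcW | ].
        exact (continuous_of_is_derive _ _ _ (HV _)).
    + apply (continuous_on_product a (fun x => V1 (W x)) time (fun x => 0 < x < 1));
        [exact Hca | ].
      intros x Hx; apply (continuous_comp W V1); [now apply HcW | ].
      exact (continuous_of_is_derive _ _ _ (HV1 _)).
    + apply (continuous_on_product a (fun x => V2 (W x)) time (fun x => 0 < x < 1));
        [exact Hca | ].
      intros x Hx; apply (continuous_comp W V2); [now apply HcW | ].
      eapply continuous_of_is_derive; unfold V2; auto_derive; [easy | reflexivity].
  - intros t x Ht Hx.
    split; [ | split; [ | split]].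
    + apply (is_derive_in_ext _ (fun s => a s * V (W x))); [easy | | ].
      * intros s Hs; now rewrite Hu.
      * apply is_derive_in_of_is_derive; unfold time in Ht; unfold a.
        auto_derive; [lra | unfold Rdiv, Rminus; field; lra].
    + apply (is_derive_ext_loc (fun y => a t * V (W y))).
      * apply (locally_of_interval 0 1); [easy | ].
        intros y Hy; now rewrite Hu.
      * apply (is_derive_scal (fun y => V (W y))), HW; easy.
    + apply (is_derive_scal (fun y => V1 (W y))), HW; easy.
    + unfold time in Ht.
      assert (Hs := sqrt_lt_R0 (1 - t) ltac:(lra)).
      assert (Hs2 := sqrt_sqrt (1 - t) ltac:(lra)).
      assert (HVV : M ^ 2 * exp (- W x ^ 2 / 2) ^ 2 * V2 (W x) = - p * V (W x)).
      { unfold V2, V.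
        replace (p * (ln M - W x ^ 2 / 2))
          with (ln M + ln M + (- W x ^ 2 / 2 + - W x ^ 2 / 2)
                + (p - 2) * (ln M - W x ^ 2 / 2)) by field.
        rewrite !exp_plus, exp_ln by easy; ring. }
      unfold solution; rewrite separated_in by easy; fold M (W x).
      replace (1 / 2 * (/ sqrt (1 - t) * (M * exp (- W x ^ 2 / 2))) ^ 2 * (a t * V2 (W x)))
        with (1 / 2 * / (sqrt (1 - t) * sqrt (1 - t)) * a t *
               (M ^ 2 * exp (- W x ^ 2 / 2) ^ 2 * V2 (W x))) by (field; lra).
      rewrite HVV, Hs2; field; lra.
Qed.

Lemma solution_is_solution (p : R) : 0 < p -> is_solution p (solution p).
Proof.
  intros Hp.
  assert (HM := amplitude_pos p Hp).
  split.
  - intros t x Ht _; unfold time in Ht.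
    apply Rmult_le_pos.
    + apply Rlt_le, Rinv_0_lt_compat, sqrt_lt_R0; lra.
    + apply Rmult_le_pos; [lra | apply profile_bounds].
  - apply (continuous_on_product (fun t => / sqrt (1 - t)) (separated p) time space).
    + intros t Ht; unfold time in Ht.
      eapply continuous_of_is_derive; auto_derive; [ | reflexivity].
      split; [lra | split; [ | easy]].
      apply Rgt_not_eq, sqrt_lt_R0; lra.
    + intros x _; now apply continuous_separated.
  - now apply solution_equation.
  - intros t _; unfold solution.
    replace (separated p 1) with (separated p 0).
    2: { rewrite <- separated_reflect by easy; f_equal; ring. }
    rewrite separated_0 by easy; lra.
Qed.

Lemma solution_le (p t x : R) :
  0 < p -> time t ->
  solution p t x <= upper_bound p (constant_of_amplitude p (amplitude p)) t.
Proof.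
  intros Hp Ht; unfold time in Ht.
  assert (HM := amplitude_pos p Hp).
  rewrite upper_bound_value by easy.
  apply Rmult_le_compat_l.
  - apply Rlt_le, Rinv_0_lt_compat, sqrt_lt_R0; lra.
  - unfold separated.
    generalize (profile_bounds p ((x - 1 / 2) / amplitude p)); nra.
Qed.

(** * Uniqueness of the constant *)

(** The parameter, on the increasing half, of the solution of amplitude M at a
    point where its value is v. *)
Definition param_of_value (M v : R) : R := - sqrt (-2 * ln (v / M)).

Lemma ln_ratio_le (M v : R) : 0 < v <= M -> ln (v / M) <= 0.
Proof.
  intros Hv; rewrite <- ln_1; apply ln_le.
  - apply Rdiv_lt_0_compat; lra.
  - apply Rmult_le_reg_r with M; [lra | ].
    unfold Rdiv; rewrite Rmult_assoc, Rinv_l; lra.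
Qed.

Lemma param_of_value_le_0 (M v : R) : param_of_value M v <= 0.
Proof. unfold param_of_value; generalize (sqrt_pos (-2 * ln (v / M))); lra. Qed.

Lemma param_of_value_sqr (M v : R) :
  0 < v <= M -> param_of_value M v ^ 2 = -2 * ln (v / M).
Proof.
  intros Hv; generalize (ln_ratio_le M v Hv); intros.
  unfold param_of_value; rewrite <- Rsqr_pow2, <- Rsqr_neg, Rsqr_sqrt; lra.
Qed.

Lemma value_of_param (M v : R) :
  0 < v <= M -> M * exp (- param_of_value M v ^ 2 / 2) = v.
Proof.
  intros Hv; rewrite param_of_value_sqr by easy.
  replace (- (-2 * ln (v / M)) / 2) with (ln (v / M)) by field.
  rewrite exp_ln by (apply Rdiv_lt_0_compat; lra); field; lra.
Qed.

Lemma param_of_value_of_param (M w : R) :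
  0 < M -> w <= 0 -> param_of_value M (M * exp (- w ^ 2 / 2)) = w.
Proof.
  intros HM Hw; unfold param_of_value.
  replace (M * exp (- w ^ 2 / 2) / M) with (exp (- w ^ 2 / 2)) by (field; lra).
  rewrite ln_exp.
  replace (-2 * (- w ^ 2 / 2)) with ((- w) ^ 2) by field.
  rewrite sqrt_pow2; lra.
Qed.

Lemma param_of_value_neg (M v : R) : 0 < v < M -> param_of_value M v < 0.
Proof.
  intros Hv.
  destruct (param_of_value_le_0 M v) as [ | H]; [easy | ].
  generalize (value_of_param M v ltac:(lra)); rewrite H.
  replace (- 0 ^ 2 / 2) with 0 by field; rewrite exp_0; lra.
Qed.

Lemma param_of_value_lt (M v w : R) :
  0 < M -> w <= 0 -> 0 < v < M * exp (- w ^ 2 / 2) -> param_of_value M v < w.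
Proof.
  intros HM Hw Hv.
  apply Rnot_le_lt; intros Hle.
  apply (Rlt_not_le _ _ (proj2 Hv)).
  assert (Hv' : v <= M).
  { assert (exp (- w ^ 2 / 2) <= 1); [ | nra].
    rewrite <- exp_0; apply exp_le_mono; generalize (pow2_ge_0 w); lra. }
  rewrite <- (value_of_param M v) by lra.
  apply Rmult_le_compat_l; [lra | ].
  apply exp_le_mono.
  generalize (param_of_value_le_0 M v); nra.
Qed.

Lemma is_derive_param_of_value (M v : R) :
  0 < v < M -> is_derive (param_of_value M) v (- / (v * param_of_value M v)).
Proof.
  intros Hv.
  assert (Hn := param_of_value_neg M v Hv).
  assert (Hs := param_of_value_sqr M v ltac:(lra)).
  unfold param_of_value in *.
  auto_derive.
  - split; [apply Rdiv_lt_0_compat; lra | split; [ | easy]].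
    change (0 < -2 * ln (v / M)); nra.
  - change (v * / M) with (v / M); field; repeat split; lra.
Qed.

(** Separation of variables: along a solution that has not reached the
    amplitude, the position on the profile moves at constant speed. *)
Lemma is_derive_position_along (p M x : R) (h : R -> R) :
  0 < h x < M ->
  is_derive h x (Rabs (slope_at p (param_of_value M (h x)))) ->
  is_derive (fun y => position p (param_of_value M (h y)) - y / M) x 0.
Proof.
  intros Hh Hd.
  set (w := param_of_value M (h x)).
  assert (Hw : w < 0) by now apply param_of_value_neg.
  evar_last.
  - apply is_derive_Rplus.
    + apply (is_derive_Rcomp (position p) (fun y => param_of_value M (h y))).
      * apply is_derive_position.
      * apply (is_derive_Rcomp (param_of_value M) h); [ | exact Hd].
        now apply is_derive_param_of_value.
    + auto_derive; [easy | reflexivity].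
  - fold w; rewrite Rabs_left by now apply slope_at_neg.
    replace (- slope_at p w * - / (h x * w) * density p w)
      with (/ (h x * w) * (density p w * slope_at p w)) by ring.
    rewrite density_slope.
    assert (Hv := value_of_param M (h x) ltac:(lra)); fold w in Hv.
    rewrite <- Hv at 1; simpl; field.
    generalize (exp_pos (- w ^ 2 / 2)); simpl; intros; repeat split; lra.
Qed.

(** What the gradient formula says, at a fixed time, of the rescaled solution
    h = sqrt (1 - t) * sigma (t, .). *)
Record rescaled (p M : R) (h : R -> R) : Prop := {
  resc_continuous : forall x, continuous h x;
  resc_0 : h 0 = 0;
  resc_half : h (1 / 2) = M;
  resc_bounds : forall x, 0 < x <= 1 / 2 -> 0 < h x <= M;
  resc_derive : forall x, 0 < x < 1 / 2 ->
    is_derive h x (Rabs (slope_at p (param_of_value M (h x))))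
}.

Lemma rescaled_mono (p M : R) (h : R -> R) (x y : R) :
  rescaled p M h -> 0 <= x -> x <= y -> y <= 1 / 2 -> h x <= h y.
Proof.
  intros [Hc _ _ _ Hd] Hx [Hxy | ->] Hy; [ | lra].
  destruct (mean_value_open h (fun z => Rabs (slope_at p (param_of_value M (h z))))
              x y Hxy) as [c [_ Hc2]].
  - intros z Hz; apply Hd; lra.
  - intros z _; apply Hc.
  - generalize (Rabs_pos (slope_at p (param_of_value M (h c)))); nra.
Qed.

(** The difference of the two sides is constant while h < M. Its value is found at
    x = 0, where h tends to 0, hence the parameter to - infinity and the position
    to [- halfwidth p]. *)
Lemma rescaled_position (p M : R) (h : R -> R) (x : R) :
  0 < p -> 0 < M -> rescaled p M h -> 0 < x < 1 / 2 -> h x < M ->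
  position p (param_of_value M (h x)) = x / M - halfwidth p.
Proof.
  intros Hp HM Hr Hx Hlt.
  set (D := fun y => position p (param_of_value M (h y)) - y / M).
  assert (HD : forall y, 0 < y <= x -> D y = D x).
  { intros y Hy; apply constant_of_derive_0; [easy | ].
    intros z Hz; apply is_derive_position_along.
    - split; [apply Hr; lra | ].
      apply Rle_lt_trans with (2 := Hlt); apply (rescaled_mono p M h); tauto || lra.
    - apply Hr; lra. }
  assert (Hge : - halfwidth p <= D x).
  { apply Rnot_lt_le; intros Hn.
    (* D y = D x is less than - halfwidth p, and so is the position at y as soon
       as y / M is at most the gap *)
    set (y := Rmin x (M * (- halfwidth p - D x))).
    assert (Hy : 0 < y) by (apply Rmin_glb_lt; nra).
    assert (Hyx := Rmin_l x (M * (- halfwidth p - D x))).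
    assert (Hyd := Rmin_r x (M * (- halfwidth p - D x))).
    fold y in Hyx, Hyd.
    specialize (HD y ltac:(lra)).
    assert (H := position_gt_opp_halfwidth p (param_of_value M (h y)) Hp).
    assert (y / M <= - halfwidth p - D x).
    { apply Rmult_le_reg_l with M; [easy | ].
      replace (M * (y / M)) with y by (field; lra); easy. }
    unfold D in *; lra. }
  assert (Hle : D x <= - halfwidth p).
  { apply Rnot_lt_le; intros Hn.
    assert (Hz : - D x < halfwidth p) by lra.
    destruct (halfwidth_approx p _ Hp Hz) as [w Hw].
    set (a := Rmax w 0).
    assert (Ha : - D x < position p a).
    { apply Rlt_le_trans with (1 := Hw), position_le_iff, Rmax_l. }
    assert (Ha0 : 0 <= a) by apply Rmax_r.
    set (v := M * exp (- (- a) ^ 2 / 2)).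
    assert (Hv : 0 < v) by (apply Rmult_lt_0_compat; [easy | apply exp_pos]).
    assert (Hc := resc_continuous _ _ _ Hr 0).
    destruct (Hc (fun z => z < v)) as [d Hd].
    { rewrite (resc_0 _ _ _ Hr).
      exists (mkposreal v Hv); intros z Hz2.
      change (Rabs (z - 0) < v) in Hz2.
      generalize (Rle_abs (z - 0)); lra. }
    set (y := Rmin x (d / 2)).
    assert (Hd0 := cond_pos d).
    assert (Hy : 0 < y) by (apply Rmin_glb_lt; lra).
    assert (Hyx := Rmin_l x (d / 2)).
    assert (Hyd := Rmin_r x (d / 2)).
    fold y in Hyx, Hyd.
    assert (Hhy : h y < v).
    { apply Hd; change (Rabs (y - 0) < d).
      rewrite Rminus_0_r, Rabs_pos_eq; lra. }
    specialize (HD y ltac:(lra)).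
    assert (Hpw : param_of_value M (h y) < - a).
    { apply param_of_value_lt; [easy | lra | ].
      split; [apply Hr; lra | exact Hhy]. }
    apply (position_incr p) in Hpw; rewrite position_opp in Hpw.
    assert (0 < y / M) by now apply Rdiv_lt_0_compat.
    unfold D in *; lra. }
  unfold D in *; lra.
Qed.

(** Below M the position would be negative, but by [rescaled_position] it is
    nonnegative from x = M * halfwidth p on. *)
Lemma rescaled_plateau (p M : R) (h : R -> R) (x : R) :
  0 < p -> 0 < M -> rescaled p M h -> M * halfwidth p < x < 1 / 2 -> h x = M.
Proof.
  intros Hp HM Hr Hx.
  assert (HL := halfwidth_pos p Hp).
  assert (Hx0 : 0 < x) by nra.
  destruct (proj2 (resc_bounds _ _ _ Hr x ltac:(lra))) as [Hlt | ]; [ | easy].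
  exfalso.
  assert (H := rescaled_position p M h x Hp HM Hr ltac:(lra) Hlt).
  assert (Hn := param_of_value_le_0 M (h x)).
  apply (position_le_iff p) in Hn; rewrite position_0, H in Hn.
  apply (Rmult_le_compat_l M) in Hn; [ | lra].
  replace (M * (x / M - halfwidth p)) with (x - M * halfwidth p) in Hn by (field; lra).
  lra.
Qed.

(** Otherwise the position would still be bounded away from 0 at x = 1/2, and h
    would skip the values just below M. *)
Lemma rescaled_length (p M : R) (h : R -> R) :
  0 < p -> 0 < M -> rescaled p M h -> M * halfwidth p <= 1 / 2.
Proof.
  intros Hp HM Hr.
  apply Rnot_lt_le; intros Hn.
  assert (HL := halfwidth_pos p Hp).
  set (z := 1 / (2 * M) - halfwidth p).
  assert (Hz : - halfwidth p < z < 0).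
  { unfold z; split.
    - assert (0 < 1 / (2 * M)) by (apply Rdiv_lt_0_compat; lra); lra.
    - apply Rmult_lt_reg_l with M; [easy | ].
      replace (M * (1 / (2 * M) - halfwidth p)) with (1 / 2 - M * halfwidth p)
        by (field; lra); lra. }
  (* z would be the position at x = 1/2; h must take the value whose position is
     z / 2 before 1/2, where the position is still less than z *)
  set (w := param p (z / 2)).
  assert (Hpw : position p w = z / 2) by (apply position_param; lra).
  assert (Hw : w < 0).
  { apply Rnot_le_lt; intros H.
    apply (position_le_iff p) in H; rewrite position_0, Hpw in H; lra. }
  assert (Hv : 0 < M * exp (- w ^ 2 / 2) < M).
  { assert (H0 := exp_pos (- w ^ 2 / 2)).
    assert (exp (- w ^ 2 / 2) < 1); [ | split; nra].
    rewrite <- exp_0; apply exp_increasing; nra. }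
  destruct (IVT_gen h 0 (1 / 2) (M * exp (- w ^ 2 / 2))) as [x [Hx Hhx]].
  - intros y; apply continuity_pt_filterlim, (resc_continuous _ _ _ Hr).
  - rewrite (resc_0 _ _ _ Hr), (resc_half _ _ _ Hr).
    rewrite Rmin_left, Rmax_right; lra.
  - rewrite Rmin_left, Rmax_right in Hx by lra.
    assert (x <> 0) by (intros ->; rewrite (resc_0 _ _ _ Hr) in Hhx; lra).
    assert (x <> 1 / 2) by (intros ->; rewrite (resc_half _ _ _ Hr) in Hhx; lra).
    assert (H1 := rescaled_position p M h x Hp HM Hr ltac:(lra) ltac:(lra)).
    rewrite Hhx, param_of_value_of_param, Hpw in H1 by lra.
    assert (Hc : 1 / (2 * M) < x / M) by (unfold z in *; lra).
    apply (Rmult_lt_compat_l M) in Hc; [ | easy].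
    replace (M * (1 / (2 * M))) with (1 / 2) in Hc by (field; lra).
    replace (M * (x / M)) with x in Hc by (field; lra).
    lra.
Qed.

Lemma slope_0_pos (p C t : R) : 0 < p -> t < 1 -> Rbar_lt 0 (slope p C t 0).
Proof.
  intros Hp Ht; rewrite slope_0 by easy.
  assert (Hs := Rinv_0_lt_compat _ (sqrt_lt_R0 (1 - t) ltac:(lra))).
  unfold end_slope; destruct (Rlt_dec p 1).
  - simpl; apply Rmult_lt_0_compat; [easy | ].
    apply Rdiv_lt_0_compat; [lra | apply sqrt_lt_R0; lra].
  - rewrite Rbar_mult_comm, (is_Rbar_mult_unique _ _ p_infty); [easy | ].
    now apply is_Rbar_mult_p_infty_pos.
Qed.

(** Extends a function on [0,1] continuously to the line, for the sake of the
    intermediate value theorem. *)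
Definition clamp (x : R) : R := Rmax 0 (Rmin x 1).

Lemma clamp_space (x : R) : space (clamp x).
Proof.
  unfold space, clamp; split; [apply Rmax_l | ].
  apply Rmax_lub; [lra | apply Rmin_r].
Qed.

Lemma clamp_id (x : R) : space x -> clamp x = x.
Proof. intros [H1 H2]; unfold clamp; rewrite Rmin_left, Rmax_right; easy. Qed.

Lemma clamp_lipschitz (x y : R) : Rabs (clamp y - clamp x) <= Rabs (y - x).
Proof.
  unfold clamp, Rmax, Rmin.
  repeat destruct Rle_dec; unfold Rabs; repeat destruct Rcase_abs; lra.
Qed.

(** The sign condition on the radicand bounds h by M. At x = 1/2 the two gradient
    formulas give opposite derivatives, so the slope is 0 there, which happens
    only at the value M. *)
Lemma solution_rescaled (p M t : R) (sigma : R -> R -> R) :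
  0 < p -> 0 < M -> time t ->
  is_solution p sigma -> gradient_formula p (constant_of_amplitude p M) sigma ->
  rescaled p M (fun x => sqrt (1 - t) * sigma t (clamp x)).
Proof.
  intros Hp HM Ht Hsol Hgr.
  assert (Ht1 : t < 1) by (unfold time in Ht; lra).
  assert (Hs := sqrt_lt_R0 (1 - t) ltac:(lra)).
  set (h := fun x => sqrt (1 - t) * sigma t (clamp x)).
  assert (Hsig : forall x, space x -> sigma t x = h x / sqrt (1 - t)).
  { intros x Hx; unfold h; rewrite clamp_id by easy; field; lra. }
  assert (Hh0 : h 0 = 0).
  { unfold h; rewrite clamp_id by (unfold space; lra).
    rewrite (proj1 (sol_boundary _ _ Hsol t Ht)); ring. }
  assert (Hpos : forall x, 0 < x <= 1 / 2 -> 0 < h x).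
  { intros x Hx.
    assert (Hsp : space x) by (unfold space; lra).
    apply Rmult_lt_0_compat; [easy | ].
    rewrite clamp_id by easy.
    destruct (sol_nonneg _ _ Hsol t x Ht Hsp) as [ | H0]; [easy | exfalso].
    assert (Hd := proj1 (proj2 (Hgr t x Ht ltac:(lra)))).
    rewrite <- H0 in Hd.
    refine (no_positive_slope_at_zero _ _ _ _ _ (eq_sym H0) _ Hd).
    - lra.
    - intros y Hy; now apply (sol_nonneg _ _ Hsol).
    - now apply slope_0_pos. }
  assert (Hbound : forall x, 0 < x <= 1 / 2 -> h x <= M).
  { intros x Hx.
    assert (Hsp : space x) by (unfold space; lra).
    assert (Hhx := Hpos x Hx).
    assert (Hr := proj1 (Hgr t x Ht ltac:(lra))).
    (* q < 0 if and only if h x > M *)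
    set (q := -2 * ln (h x / M)).
    assert (Hhq : h x = M * exp (- q / 2)).
    { unfold q; replace (- (-2 * ln (h x / M)) / 2) with (ln (h x / M)) by field.
      rewrite exp_ln by now apply Rdiv_lt_0_compat.
      field; lra. }
    rewrite Hsig, Hhq, radicand_value in Hr by easy; simpl in Hr.
    assert (He := expmean_pos ((p - 1) * q)).
    assert (Hq : 0 <= q).
    { apply Rnot_lt_le; intros Hn.
      assert (0 < p * (p * 1)) by nra.
      assert (q * expmean ((p - 1) * q) < 0) by nra.
      nra. }
    rewrite Hhq.
    assert (exp (- q / 2) <= 1); [ | nra].
    rewrite <- exp_0; apply exp_le_mono; lra. }
  assert (Hslope : forall x, 0 < x <= 1 / 2 ->
            slope p (constant_of_amplitude p M) t (sigma t x) =
            Finite (/ sqrt (1 - t) * Rabs (slope_at p (param_of_value M (h x))))).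
  { intros x Hx.
    rewrite <- slope_value with (M := M) by easy.
    rewrite value_of_param, Hsig; [easy | unfold space; lra | ].
    split; [now apply Hpos | now apply Hbound]. }
  assert (Hder : forall x s, 0 < x < 1 ->
            is_derive_in space (sigma t) x (Finite (/ sqrt (1 - t) * s)) ->
            is_derive h x s).
  { intros x s Hx Hd.
    assert (Hl : locally x space).
    { apply (locally_of_interval 0 1); [lra | unfold space; intros; lra]. }
    apply is_derive_of_is_derive_in with (1 := Hl).
    apply (is_derive_in_ext _ (fun y => sqrt (1 - t) * sigma t y)).
    - unfold space; lra.
    - intros y Hy; unfold h; now rewrite clamp_id.
    - replace (Finite s) with (Rbar_mult (sqrt (1 - t)) (Finite (/ sqrt (1 - t) * s))).
      + now apply is_derive_in_scal.
      + simpl; f_equal; field; lra. }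
  split; [ | exact Hh0 | | | ].
  - intros x.
    assert (Hc := sol_continuous _ _ Hsol (t, clamp x) (conj Ht (clamp_space x))).
    apply (continuous_mult (K := R_AbsRing) (fun _ => sqrt (1 - t))).
    + apply continuous_const.
    + intros P HP.
      destruct (Hc P HP) as [d Hd].
      exists d; intros y Hy.
      apply (Hd (t, clamp y)).
      * split; [apply ball_center | ].
        exact (Rle_lt_trans _ _ _ (clamp_lipschitz x y) Hy).
      * split; [exact Ht | apply clamp_space].
  - assert (Hx : 0 < 1 / 2 <= 1 / 2) by lra.
    destruct (Hgr t (1 / 2) Ht ltac:(lra)) as [_ [H1 H2]].
    replace (1 - 1 / 2) with (1 / 2) in H2 by field.
    rewrite Hslope in H1, H2 by lra.
    set (w := param_of_value M (h (1 / 2))) in *.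
    simpl Rbar_opp in H2; rewrite Ropp_mult_distr_r in H2.
    apply Hder in H1; [ | lra].
    apply Hder in H2; [ | lra].
    apply is_derive_unique in H1, H2.
    assert (Hz : Rabs (slope_at p w) = 0) by lra.
    destruct (param_of_value_le_0 M (h (1 / 2))) as [Hn | H0].
    + apply (slope_at_neg p) in Hn; fold w in Hn.
      apply Rabs_eq_0 in Hz; lra.
    + rewrite <- (value_of_param M (h (1 / 2))), H0.
      * replace (- 0 ^ 2 / 2) with 0 by field; rewrite exp_0; ring.
      * split; [now apply Hpos | now apply Hbound].
  - intros x Hx; split; [now apply Hpos | now apply Hbound].
  - intros x Hx.
    apply Hder; [lra | ].
    rewrite <- Hslope by lra.
    apply Hgr; [easy | lra].
Qed.

(** A solution that reaches its amplitude M before x = 1/2 stays there; then it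
    is M / sqrt (1 - t) on a whole interval, at every time. This is not constant
    in time, but its second space derivative is 0, against the equation. *)
Lemma no_plateau (p M a b : R) (sigma : R -> R -> R) :
  0 < p -> 0 < M -> 0 <= a -> a < b -> b <= 1 -> is_solution p sigma ->
  ~ (forall t x, time t -> a < x < b -> sigma t x = M / sqrt (1 - t)).
Proof.
  intros Hp HM Ha Hab Hb Hsol Hsig.
  destruct (sol_equation _ _ Hsol) as [ut [ux [uxx [_ Heq]]]].
  set (F := fun t => exp (p * (ln M - ln (1 - t) / 2))).
  assert (HF : forall t x, time t -> a < x < b -> rpow (sigma t x) p = F t).
  { intros t x Ht Hx; rewrite Hsig by easy; unfold time in Ht.
    assert (Hs := sqrt_lt_R0 (1 - t) ltac:(lra)).
    unfold rpow, F; destruct (Rlt_dec 0 (M / sqrt (1 - t))) as [_ | Hn].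
    - unfold Rpower; do 2 f_equal.
      rewrite ln_div by easy.
      rewrite <- (sqrt_sqrt (1 - t)) at 2 by lra.
      rewrite ln_mult by easy; field.
    - exfalso; apply Hn; now apply Rdiv_lt_0_compat. }
  (* any interior time; there the derivative restricted to [0,1) is the usual one *)
  assert (Ht : time (1 / 2)) by (unfold time; lra).
  assert (Hux : forall x, a < x < b -> ux (1 / 2) x = 0).
  { intros x Hx.
    assert (H := proj1 (proj2 (Heq (1 / 2) x Ht ltac:(lra)))).
    apply is_derive_unique in H; rewrite <- H.
    apply is_derive_unique, (is_derive_ext_loc (fun _ => F (1 / 2))).
    - apply (locally_of_interval a b); [easy | ].
      intros y Hy; now rewrite HF.
    - apply (is_derive_const (K := R_AbsRing) (V := R_NormedModule)). }
  set (x := (a + b) / 2).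
  assert (Hx : a < x < b) by (unfold x; lra).
  destruct (Heq (1 / 2) x Ht ltac:(lra)) as [Hut [_ [Huxx Hpde]]].
  assert (Huxx0 : uxx (1 / 2) x = 0).
  { apply is_derive_unique in Huxx; rewrite <- Huxx.
    apply is_derive_unique, (is_derive_ext_loc (fun _ => 0)).
    - apply (locally_of_interval a b); [easy | ].
      intros y Hy; now rewrite Hux.
    - apply (is_derive_const (K := R_AbsRing) (V := R_NormedModule)). }
  assert (Hut0 : ut (1 / 2) x = p * F (1 / 2)).
  { assert (Hl : locally (1 / 2) time).
    { apply (locally_of_interval 0 1); [lra | unfold time; intros; lra]. }
    apply is_derive_of_is_derive_in with (1 := Hl) in Hut.
    apply is_derive_unique in Hut; rewrite <- Hut.
    apply is_derive_unique, (is_derive_ext_loc F).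
    - refine (locally_imp2 _ _ _ _ _ Hl Hl); intros s Hs' _; now rewrite HF.
    - unfold F; auto_derive; [lra | ].
      unfold Rdiv, Rminus; field. }
  assert (H0 := exp_pos (p * (ln M - ln (1 - 1 / 2) / 2))).
  fold (F (1 / 2)) in H0.
  rewrite Huxx0, Hut0 in Hpde; nra.
Qed.

Lemma amplitude_unique (p M : R) (sigma : R -> R -> R) :
  0 < p -> 0 < M ->
  is_solution p sigma -> gradient_formula p (constant_of_amplitude p M) sigma ->
  M = amplitude p.
Proof.
  intros Hp HM Hsol Hgr.
  assert (HL := halfwidth_pos p Hp).
  assert (Hresc := fun t Ht => solution_rescaled p M t sigma Hp HM Ht Hsol Hgr).
  assert (Hle : M * halfwidth p <= 1 / 2).
  { apply (rescaled_length p M _ Hp HM (Hresc 0 ltac:(unfold time; lra))). }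
  destruct Hle as [Hlt | Heq].
  - exfalso.
    refine (no_plateau p M (M * halfwidth p) (1 / 2) sigma Hp HM _ Hlt _ Hsol _);
      [nra | lra | ].
    intros t x Ht Hx.
    assert (Hs := sqrt_lt_R0 (1 - t) ltac:(unfold time in Ht; lra)).
    assert (H := rescaled_plateau p M _ x Hp HM (Hresc t Ht) Hx).
    simpl in H; rewrite clamp_id in H by (unfold space; nra).
    rewrite <- H; field; lra.
  - unfold amplitude; apply Rmult_eq_reg_r with (2 * halfwidth p); [ | lra].
    rewrite Rinv_l; lra.
Qed.

(** * The constants for p = 1/2 and p = 1 *)

(** The slope is linear in the position because, for p = 1/2, the solution is a
    parabola. *)
Lemma position_half (w : R) : position (1 / 2) w = slope_at (1 / 2) w.
Proof.
  set (D := fun x => position (1 / 2) x - slope_at (1 / 2) x).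
  assert (Hd : forall x, is_derive D x 0).
  { intros x; unfold D; evar_last.
    - apply (is_derive_minus (K := R_AbsRing) (V := R_NormedModule)).
      + apply is_derive_position.
      + apply is_derive_slope_at.
    - unfold density, minus, plus, opp; simpl.
      replace ((1 / 2 - 1) * (x * (x * 1))) with (- (x * (x * 1)) / 2) by field.
      ring. }
  assert (H0 : D 0 = 0).
  { unfold D; rewrite position_0; unfold slope_at; ring. }
  apply Rminus_diag_uniq; change (D w = 0).
  destruct (Rle_dec 0 w) as [Hw | Hw].
  - rewrite <- H0; symmetry; now apply constant_of_derive_0.
  - rewrite <- H0; apply constant_of_derive_0; [lra | easy].
Qed.

Lemma halfwidth_half : halfwidth (1 / 2) = sqrt 2.
Proof.
  assert (H1 := is_lim_position (1 / 2) ltac:(lra)).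
  assert (H2 := filterlim_comp _ _ _ _ _ _ _ _ (filterlim_Rbar_opp p_infty)
                  (slope_at_lim (1 / 2))).
  unfold end_slope in H2; destruct (Rlt_dec (1 / 2) 1); [ | lra].
  assert (H3 : is_lim (position (1 / 2)) p_infty (1 / sqrt (1 - 1 / 2))).
  { apply (filterlim_ext (fun w => - slope_at (1 / 2) (- w))); [ | exact H2].
    intros w; rewrite position_half, slope_at_opp; ring. }
  apply is_lim_unique in H1, H3.
  assert (H4 : halfwidth (1 / 2) = 1 / sqrt (1 - 1 / 2)).
  { rewrite H1 in H3; now injection H3. }
  rewrite H4; replace (1 - 1 / 2) with (/ 2) by field.
  rewrite sqrt_inv; field.
  apply Rgt_not_eq, sqrt_lt_R0; lra.
Qed.

Lemma constant_half : constant_of_amplitude (1 / 2) (amplitude (1 / 2)) = sqrt 2.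
Proof.
  assert (HM := amplitude_pos (1 / 2) ltac:(lra)).
  unfold constant_of_amplitude; destruct (Req_EM_T (1 / 2) 1); [lra | ].
  replace (2 * (1 / 2) - 2) with (- (1)) by field.
  rewrite Rpower_Ropp, Rpower_1 by easy.
  unfold amplitude; rewrite Rinv_inv, halfwidth_half, Rabs_left by lra.
  field.
Qed.

Lemma density_1 (w : R) : density 1 w = exp (- w ^ 2 / 2).
Proof.
  unfold density; rewrite Rminus_diag, Rmult_0_l, expmean_0, sqrt_1; field.
Qed.

(** Auxiliary integral of the classical evaluation of the Gaussian integral: by
    differentiation under the integral sign, [position 1 x ^ 2 + 2 * gauss_aux x]
    does not depend on x. *)
Definition gauss_aux (x : R) : R :=
  RInt (fun s => exp (- x ^ 2 * (1 + s ^ 2) / 2) / (1 + s ^ 2)) 0 1.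

Lemma one_plus_sqr_pos (s : R) : 0 < 1 + s ^ 2.
Proof. generalize (pow2_ge_0 s); lra. Qed.

Lemma ex_RInt_gauss_aux (x : R) :
  ex_RInt (fun s => exp (- x ^ 2 * (1 + s ^ 2) / 2) / (1 + s ^ 2)) 0 1.
Proof.
  apply (ex_RInt_continuous (V := R_CompleteNormedModule)); intros s _.
  eapply continuous_of_is_derive; auto_derive; [ | reflexivity].
  generalize (one_plus_sqr_pos s); simpl; lra.
Qed.

(** After differentiation the factor 1 + s^2 cancels, and the substitution
    y = x s turns the integral into [position 1 x]. *)
Lemma is_derive_gauss_aux (x : R) :
  is_derive gauss_aux x (- exp (- x ^ 2 / 2) * position 1 x).
Proof.
  set (f := fun x s => exp (- x ^ 2 * (1 + s ^ 2) / 2) / (1 + s ^ 2)).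
  assert (exp_sqr_continuity : forall z, continuity_pt (fun z => exp (- z ^ 2 / 2)) z).
  { intros z; apply (proj2 (continuity_pt_filterlim (fun z => exp (- z ^ 2 / 2)) z)).
    apply (continuous_of_is_derive (fun z => exp (- z ^ 2 / 2)) z
             (- z * exp (- z ^ 2 / 2))).
    auto_derive; [easy | simpl; unfold Rdiv; field]. }
  assert (Hf : forall y s, is_derive (fun u => f u s) y
                 (- exp (- y ^ 2 / 2) * (y * exp (- (y * s) ^ 2 / 2)))).
  { intros y s; unfold f.
    assert (Hs := one_plus_sqr_pos s).
    auto_derive; [easy | ].
    replace (- exp (- y ^ 2 / 2) * (y * exp (- (y * s) ^ 2 / 2)))
      with (- y * (exp (- y ^ 2 / 2) * exp (- (y * s) ^ 2 / 2))) by ring.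
    rewrite <- exp_plus.
    replace (- y ^ 2 / 2 + - (y * s) ^ 2 / 2)
      with (- (y * (y * 1)) * (1 + s * (s * 1)) * / 2) by (simpl; field).
    field; simpl in Hs; lra. }
  evar_last.
  - apply (is_derive_RInt_param f 0 1 x).
    + apply filter_forall; intros y s _.
      now exists (- exp (- y ^ 2 / 2) * (y * exp (- (y * s) ^ 2 / 2))).
    + intros s _.
      apply (continuity_2d_pt_ext
               (fun u v => - exp (- u ^ 2 / 2) * (u * exp (- (u * v) ^ 2 / 2)))).
      { intros u v; symmetry; apply is_derive_unique, Hf. }
      refine (continuity_2d_pt_mult (fun u _ => - exp (- u ^ 2 / 2))
                (fun u v => u * exp (- (u * v) ^ 2 / 2)) _ _ _ _).
      * apply continuity_2d_pt_opp.
        refine (continuity_1d_2d_pt_comp (fun u => exp (- u ^ 2 / 2)) (fun u _ => u)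
                  _ _ _ _).
        -- apply exp_sqr_continuity.
        -- apply continuity_2d_pt_id1.
      * refine (continuity_2d_pt_mult (fun u _ => u)
                  (fun u v => exp (- (u * v) ^ 2 / 2)) _ _ _ _);
          [apply continuity_2d_pt_id1 | ].
        refine (continuity_1d_2d_pt_comp (fun z => exp (- z ^ 2 / 2)) (fun u v => u * v)
                  _ _ _ _).
        -- apply exp_sqr_continuity.
        -- refine (continuity_2d_pt_mult (fun u _ => u) (fun _ v => v) _ _ _ _);
             [apply continuity_2d_pt_id1 | apply continuity_2d_pt_id2].
    + apply filter_forall; intros y; apply ex_RInt_gauss_aux.
  - assert (H : is_RInt (density 1) (x * 0 + 0) (x * 1 + 0) (position 1 x)).
    { rewrite Rmult_0_r, Rmult_1_r, !Rplus_0_r.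
      apply (RInt_correct (V := R_CompleteNormedModule)).
      apply (ex_RInt_continuous (V := R_CompleteNormedModule)).
      intros s _; apply continuous_density. }
    apply (is_RInt_comp_lin (V := R_NormedModule)) in H.
    apply (is_RInt_scal _ _ _ (- exp (- x ^ 2 / 2))) in H.
    apply (is_RInt_unique (V := R_CompleteNormedModule)).
    refine (is_RInt_ext _ _ _ _ _ _ H).
    intros s _; simpl; rewrite density_1, Rplus_0_r.
    symmetry; apply is_derive_unique, Hf.
Qed.

Lemma gauss_aux_0 : gauss_aux 0 = PI / 4.
Proof.
  unfold gauss_aux.
  rewrite (RInt_ext _ (fun s => / (1 + s ^ 2))).
  - replace (PI / 4) with (minus (atan 1) (atan 0)).
    2: { rewrite atan_1, atan_0; apply Rminus_0_r. }
    apply is_RInt_unique.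
    apply (is_RInt_derive (V := R_CompleteNormedModule) atan).
    + intros x _; apply is_derive_Reals.
      apply derivable_pt_lim_atan.
    + intros x _; eapply continuous_of_is_derive; auto_derive; [ | reflexivity].
      generalize (one_plus_sqr_pos x); simpl; lra.
  - intros s _.
    replace (- 0 ^ 2 * (1 + s ^ 2) / 2) with 0 by field.
    rewrite exp_0; apply Rmult_1_l.
Qed.

Lemma gauss_aux_bounds (x : R) : 0 <= gauss_aux x <= exp (- x ^ 2 / 2).
Proof.
  assert (Hb : forall s, 0 <= exp (- x ^ 2 * (1 + s ^ 2) / 2) / (1 + s ^ 2)
                         <= exp (- x ^ 2 / 2)).
  { intros s.
    assert (Hs := pow2_ge_0 s).
    assert (He := exp_pos (- x ^ 2 * (1 + s ^ 2) / 2)).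
    split; [apply Rdiv_le_0_compat; lra | ].
    apply Rle_trans with (exp (- x ^ 2 * (1 + s ^ 2) / 2)).
    - apply Rmult_le_reg_r with (1 + s ^ 2); [lra | ].
      unfold Rdiv at 1; rewrite Rmult_assoc, Rinv_l by lra; nra.
    - apply exp_le_mono; generalize (pow2_ge_0 x); nra. }
  split.
  - apply RInt_ge_0; [lra | apply ex_RInt_gauss_aux | intros s _; apply Hb].
  - replace (exp (- x ^ 2 / 2)) with (RInt (fun _ => exp (- x ^ 2 / 2)) 0 1).
    2: { rewrite RInt_const; unfold scal; simpl; unfold mult; simpl; ring. }
    apply RInt_le; [lra | apply ex_RInt_gauss_aux | apply ex_RInt_const | ].
    intros s _; apply Hb.
Qed.

Lemma position_1_sqr (x : R) : 0 <= x -> position 1 x ^ 2 = PI / 2 - 2 * gauss_aux x.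
Proof.
  intros Hx.
  assert (H := constant_of_derive_0
                 (fun x => position 1 x * position 1 x + 2 * gauss_aux x) 0 x Hx).
  simpl in H; rewrite position_0, gauss_aux_0 in H.
  enough (0 * 0 + 2 * (PI / 4) =
          position 1 x * position 1 x + 2 * gauss_aux x) by (simpl; lra).
  apply H; intros y _.
  evar_last.
  - apply is_derive_Rplus.
    + apply is_derive_Rmult; apply is_derive_position.
    + apply (is_derive_scal gauss_aux), is_derive_gauss_aux.
  - rewrite density_1; simpl; ring.
Qed.

Lemma halfwidth_1_sqr : halfwidth 1 ^ 2 = PI / 2.
Proof.
  assert (HL := is_lim_position 1 Rlt_0_1).
  assert (H1 : is_lim (fun x => position 1 x ^ 2) p_infty (halfwidth 1 ^ 2)).
  { apply (is_lim_comp_continuous (position 1) (fun v => v ^ 2) p_infty (halfwidth 1));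
      [exact HL | ].
    eapply continuous_of_is_derive; auto_derive; [easy | reflexivity]. }
  assert (H2 : is_lim (fun x => position 1 x ^ 2) p_infty (PI / 2)).
  { apply (is_lim_le_le_loc (fun x => PI / 2 - 2 * exp (- x)) (fun _ => PI / 2)).
    - exists 2; intros x Hx.
      rewrite position_1_sqr by lra.
      assert (Hb := gauss_aux_bounds x).
      assert (exp (- x ^ 2 / 2) <= exp (- x)); [apply exp_le_mono; nra | lra].
    - replace (Finite (PI / 2)) with (Finite (PI / 2 - 2 * 0)) by (f_equal; ring).
      apply (is_lim_comp_continuous (fun x => exp (- x)) (fun v => PI / 2 - 2 * v)).
      + exact (filterlim_comp _ _ _ _ _ _ _ _ (filterlim_Rbar_opp p_infty) is_lim_exp_m).
      + eapply continuous_of_is_derive; auto_derive; [easy | reflexivity].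
    - apply is_lim_const. }
  apply is_lim_unique in H1, H2.
  rewrite H1 in H2; now injection H2.
Qed.

Lemma constant_1 : constant_of_amplitude 1 (amplitude 1) = ln (2 * PI).
Proof.
  assert (HL := halfwidth_pos 1 Rlt_0_1).
  unfold constant_of_amplitude; destruct (Req_EM_T 1 1); [ | easy].
  unfold amplitude; rewrite ln_Rinv by lra.
  replace (2 * PI) with (2 * halfwidth 1 * (2 * halfwidth 1)).
  - rewrite (ln_mult (2 * halfwidth 1) (2 * halfwidth 1)) by lra; ring.
  - replace (2 * halfwidth 1 * (2 * halfwidth 1)) with (4 * halfwidth 1 ^ 2) by ring.
    rewrite halfwidth_1_sqr; field.
Qed.

Lemma constant_pos (p : R) : 0 < p -> 0 < constant_of_amplitude p (amplitude p).
Proof.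
  intros Hp; destruct (Req_dec p 1) as [-> | Hne].
  - rewrite constant_1, <- ln_1; apply ln_increasing; [lra | ].
    generalize PI2_1; lra.
  - unfold constant_of_amplitude; destruct (Req_EM_T p 1); [easy | ].
    apply Rmult_lt_0_compat; [ | apply exp_pos].
    apply Rdiv_lt_0_compat; [apply pow_lt; lra | apply Rabs_pos_lt; lra].
Qed.

Theorem proposition3p4 :
  forall p : R, 0 < p ->
  exists C : R,
    0 < C /\
    (exists sigma : R -> R -> R,
       is_solution p sigma /\
       gradient_formula p C sigma /\
       (forall t x, time t -> space x -> sigma t x <= upper_bound p C t) /\
       (forall t x, time t -> space x ->
          (sigma t x = 0 <-> x = 0 \/ x = 1))) /\
    (forall C' : R, 0 < C' ->
       (exists sigma' : R -> R -> R,
          is_solution p sigma' /\ gradient_formula p C' sigma') ->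
       C' = C) /\
    (p = 1 / 2 -> C = sqrt 2) /\
    (p = 1 -> C = ln (2 * PI)).
Proof.
  intros p Hp.
  assert (Hsol := solution_is_solution p Hp).
  exists (constant_of_amplitude p (amplitude p)).
  split; [now apply constant_pos | split; [ | split; [ | split]]].
  - exists (solution p).
    split; [exact Hsol | split; [now apply solution_gradient | split]].
    + intros t x Ht _; now apply solution_le.
    + intros t x Ht Hx; split.
      * intros H0; unfold space in Hx.
        destruct (Req_dec x 0); [now left | ].
        destruct (Req_dec x 1); [now right | ].
        generalize (solution_pos p t x Hp Ht ltac:(lra)); lra.
      * intros [-> | ->]; apply (sol_boundary _ _ Hsol t Ht).
  - intros C' HC' [sigma' [Hsol' Hgr']].
    destruct (constant_of_amplitude_surjective p C' Hp HC') as [M [HM <-]].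
    now rewrite (amplitude_unique p M sigma' Hp HM Hsol' Hgr').
  - intros ->; exact constant_half.
  - intros ->; exact constant_1.
Qed.
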